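(* Let $\mathcal A$ be a finite alphabet, the set of all terminal symbols. Let $\mathbf R\subseteq\mathbb N$ be the set of codes of regularly total productive context-free grammars over $\mathcal A$, and let $\bar{\mathbf T}\subseteq\mathbb N$ be the set of codes of productive context-free grammars over $\mathcal A$ that are not total. Then $\mathbf R$ and $\bar{\mathbf T}$ are effectively inseparable.
   Context: Grammars. Fix the finite alphabet $\mathcal A$ as the set of all terminal symbols, and let $\mathcal V$, a countably infinite set disjoint from $\mathcal A$, be the set of all non-terminal symbols, among which there is a designated start symbol $S\in\mathcal V$. A context-free grammar (CFG) over $\mathcal A$ is given by finitely many productions $X\Rightarrow\alpha_1\cdots\alpha_n$ with $X\in\mathcal V$ and each $\alpha_i\in\mathcal A\cup\mathcal V$. A CFG is productive if in every production $X\Rightarrow\alpha_1\cdots\alpha_n$ some $\alpha_i$ is a terminal, i.e. some $\alpha_i\in\mathcal A$. Productive CFGs are identified with natural numbers via a fixed reasonable (Gödel) coding. A productive CFG is total if it generates from $S$ all non-empty words over $\mathcal A$. A productive CFG $G$ is regularly total if it includes two designated non-terminals $Y,T\in\mathcal V$ such that: (a) for each $a\in\mathcal A$, $G$ includes the productions $S\Rightarrow aYT$, $T\Rightarrow a$ and $T\Rightarrow aT$; and (b) there is some $n>0$ such that $S$ generates all non-empty words over $\mathcal A$ of length $\le n+1$, and $Y$ generates all words over $\mathcal A$ of length $n$. Effective inseparability. Fix an acceptable enumeration $(f_n)_{n\in\mathbb N}$ of the one-input partial recursive functions on $\mathbb N$, and let $W_n=\mathrm{dom}(f_n)$. Sets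 $A,B\subseteq\mathbb N$ are effectively inseparable if $A\cap B=\varnothing$ and there is a partial recursive function $h(x,y)$ such that, whenever $W_u\supseteq A$, $W_v\supseteq B$ and $W_u\cap W_v=\varnothing$, the value $h(u,v)$ is defined and $h(u,v)\notin W_u\cup W_v$.
   Formalization: The alphabet is assumed to have at least two letters; for an empty or one-letter alphabet the claim is false, since totality of productive context-free grammars is then decidable and the two sets are recursively separable. *)

(* Defs.v *)
From Stdlib Require Import Relations.
From mathcomp Require Import all_boot.
From mathcomp Require Import boolp classical_sets.

Set Implicit Arguments.
Unset Strict Implicit.
Unset Printing Implicit Defensive.

Local Open Scope classical_set_scope.

(* Partial functions are represented by their graphs: for [phi : nat -> nat ->
   Prop], [phi x y] means that phi(x) is defined and equal to y. *)

(* Programs for the n-ary partial recursive (i.e. mu-recursive) functions. *)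
Inductive murec : nat -> Type :=
| MZero n : murec n
| MSucc : murec 1
| MProj n of 'I_n : murec n
| MComp n m of murec m & ('I_m -> murec n) : murec n
| MRec n of murec n & murec n.+2 : murec n.+1
| MMin n of murec n.+1 : murec n.

(* [MRec g h] is f(0, v) = g(v), f(k+1, v) = h(k, f(k, v), v); [MMin g] at v is
   the least y with g(y, v) = 0, all the values g(i, v), i < y, being defined. *)
Fixpoint murec_graph n (p : murec n) : n.-tuple nat -> nat -> Prop :=
  match p in murec n return n.-tuple nat -> nat -> Prop with
  | MZero _ => fun _ y => y = 0
  | MSucc => fun v y => y = (thead v).+1
  | MProj _ i => fun v y => y = tnth v i
  | MComp _ m g hs => fun v y => exists w : m.-tuple nat,
      (forall i, murec_graph (hs i) v (tnth w i)) /\ murec_graph g w y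
  | MRec n g h => fun v y =>
      let t : n.-tuple nat := [tuple of behead v] in
      let fix rec (k : nat) : nat -> Prop :=
        match k with
        | 0 => murec_graph g t
        | k'.+1 => fun y => exists z,
            rec k' z /\ murec_graph h [tuple of k' :: z :: t] y
        end in
      rec (thead v) y
  | MMin _ g => fun v y =>
      murec_graph g [tuple of y :: v] 0 /\
      forall i, i < y -> exists z, murec_graph g [tuple of i :: v] z.+1
  end.

Definition partial_recursive1 (phi : nat -> nat -> Prop) : Prop :=
  exists p : murec 1, forall x y, phi x y <-> murec_graph p [tuple x] y.

Definition partial_recursive2 (phi : nat -> nat -> nat -> Prop) : Prop :=
  exists p : murec 2, forall x y z, phi x y z <-> murec_graph p [tuple x; y] z.

Definition total_recursive1 (c : nat -> nat) : Prop :=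
  partial_recursive1 (fun x y => y = c x).

(* [f n x y] means f_n(x) = y.  The conditions are: (f_n) enumerates exactly
   the one-input partial recursive functions; it has a partial recursive
   universal function; it satisfies the s-m-n (parametrization) property. *)
Definition acceptable_enumeration (f : nat -> nat -> nat -> Prop) : Prop :=
  [/\ forall phi : nat -> nat -> Prop,
        partial_recursive1 phi <->
        exists n, forall x y, f n x y <-> phi x y,
      partial_recursive2 f
    & forall g : nat -> nat -> nat -> Prop, partial_recursive2 g ->
        exists2 c : nat -> nat, total_recursive1 c &
          forall x y z, f (c x) y z <-> g x y z].

Definition W (f : nat -> nat -> nat -> Prop) (n : nat) : set nat :=
  [set x | exists y, f n x y].

Definition effectively_inseparable (f : nat -> nat -> nat -> Prop)
    (A B : set nat) : Prop :=
  A `&` B = set0 /\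
  exists2 h : nat -> nat -> nat -> Prop, partial_recursive2 h &
    forall u v, A `<=` W f u -> B `<=` W f v -> W f u `&` W f v = set0 ->
      exists2 z, h u v z & ~ (W f u `|` W f v) z.

(* The non-terminals are the natural numbers, tagged by [inr] in words. *)
Notation nonterminal := nat (only parsing).
Definition start : nonterminal := 0.

Section Grammars.
Variable A : finType.

Definition symbol := (A + nonterminal)%type.
Definition production := (nonterminal * seq symbol)%type.
Definition grammar := seq production.

Definition terminal (a : A) : symbol := inl a.
Definition variable (X : nonterminal) : symbol := inr X.

Definition productive (G : grammar) : bool :=
  all (fun p : production => has (fun s => if s is inl _ then true else false)
                                 p.2) G.

Definition derives1 (G : grammar) (x y : seq symbol) : Prop :=
  exists u v : seq symbol, exists2 p : production, p \in G &
    x = u ++ variable p.1 :: v /\ y = u ++ p.2 ++ v.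

Definition generates (G : grammar) (X : nonterminal) (w : seq A) : Prop :=
  clos_refl_trans _ (derives1 G) [:: variable X] (map terminal w).

Definition total_grammar (G : grammar) : Prop :=
  forall w : seq A, w != [::] -> generates G start w.

Definition regularly_total (G : grammar) : Prop :=
  exists Y T : nonterminal,
    [/\ Y != T,
        forall a : A,
          [/\ (start, [:: terminal a; variable Y; variable T]) \in G,
              (T, [:: terminal a]) \in G
            & (T, [:: terminal a; variable T]) \in G]
      & exists n : nat,
          [/\ 0 < n,
              forall w : seq A, w != [::] -> size w <= n.+1 ->
                generates G start w
            & forall w : seq A, size w = n -> generates G Y w]].

(* Gödel numbering; [CodeSeq.code] is a computable bijection from [seq nat]
   to [nat], so that the three functions below are injective. *)
Definition symbol_code (s : symbol) : nat :=
  match s with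
  | inl a => (enum_rank a).*2
  | inr X => X.*2.+1
  end.

Definition production_code (p : production) : nat :=
  CodeSeq.code (p.1 :: map symbol_code p.2).

Definition grammar_code (G : grammar) : nat :=
  CodeSeq.code (map production_code G).

Definition regularly_total_codes : set nat :=
  [set grammar_code G | G in [set G | productive G /\ regularly_total G]].

Definition non_total_codes : set nat :=
  [set grammar_code G | G in [set G | productive G /\ ~ total_grammar G]].

End Grammars.

(* Main.v *)
Require Import Defs.
From Stdlib Require Import Relations.
From mathcomp Require Import all_boot.
From mathcomp Require Import boolp classical_sets.
From mathcomp Require Import zify.

Set Implicit Arguments.
Unset Strict Implicit.
Unset Printing Implicit Defensive.

(** Regularly total grammars are total ([regularly_total_total]), so the two sets are
disjoint. Effective inseparability comes from a diagonal argument. The core is a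
computable map from [x] to productive grammars [G_x] such that [G_x] is regularly
total if [f_x(x) = 0] and is not total if [f_x(x)] is defined and positive. Given [u]
and [v], the parametrization property yields an index [e] of the function which, on
input [x], searches in parallel whether the code of [G_x] enters [W_u] or [W_v] and
answers 1 in the first case and 0 in the second ([race]). Suppose that [W_u] and
[W_v] are disjoint and contain the codes of regularly total and of non-total
grammars. If the code of [G_e] were in [W_u], then [f_e(e) = 1], so [G_e] would not be
total and its code would be in [W_v] too; if it were in [W_v], then [f_e(e) = 0], so
[G_e] would be regularly total and its code would be in [W_u] too. Hence it is in
neither set, and it is computable from [u] and [v].

The grammar [G_x] generates the words that are not computation histories. To make
this easy, the computation of [f_x(x)] is first translated into the iteration of a
generalized Collatz map, whose state is a single number and whose step is affine on
each residue class ([simulation]): recursive functions become register programs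
([compile]), these become machine code ([exec_reach]), and the machine is coded in
one number by prime powers ([next_step]). Only terminating computations need to be
simulated. A history is then the sequence of the numbers of the run, in unary, as
blocks of a letter [a] closed by other letters, and it is wrong as soon as two
adjacent blocks do not fit together. This is a comparison of two lengths up to an
affine map, which a context-free grammar can make.

Roughly, S generates the words [c w] for which [w] is not an accepting history, and Y
generates words that are not prefixes of accepting histories. If the run accepts,
with history [H], then no [c H] is generated, not even through [S => c Y T], since Y
would have to generate a prefix of [H] ([not_total_run]). If the run ends without
accepting, there is no accepting history, so the rules other than [S => c Y T] already
give all non-empty words; and a word longer than the run must contain an error or
continue after the end, so Y generates all words of some large length
([regularly_total_run]). The initial number affects only the productions for wrong
first blocks, so the code of [G_x] is computable ([recursive_grammar_code]).

The parallel search needs to evaluate programs with a bounded budget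
([step_boundedP]). *)

(** * Total recursive functions *)

Definition recursive n (F : n.-tuple nat -> nat) : Prop :=
  exists p : murec n, forall v y, murec_graph p v y <-> y = F v.

(** Substitutions are tuple-valued functions, so that closure under composition
is the single lemma [recursive_subst], whose side condition is discharged
entry by entry. *)
Definition tuple_recursive n m (T : n.-tuple nat -> m.-tuple nat) : Prop :=
  forall i, recursive (fun v => tnth (T v) i).

Lemma eq_recursive n (F G : n.-tuple nat -> nat) :
  F =1 G -> recursive F -> recursive G.
Proof. by move=> /funext->. Qed.

Lemma recursive_proj n (i : 'I_n) : recursive (fun v => tnth v i).
Proof. by exists (MProj i). Qed.

Lemma recursive_subst n m (F : m.-tuple nat -> nat) (T : n.-tuple nat -> m.-tuple nat) :
  recursive F -> tuple_recursive T -> recursive (fun v => F (T v)).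
Proof.
case=> p Hp /choice[q Hq]; exists (MComp p q) => v y /=; split.
  case=> w [Hw /Hp->]; congr (F _); apply: eq_from_tnth => i.
  exact/Hq.
by move=> ->; exists (T v); split=> [i|]; [apply/Hq | apply/Hp].
Qed.

Lemma tuple_recursive_id n : tuple_recursive (fun v : n.-tuple nat => v).
Proof. by move=> i; apply: recursive_proj. Qed.

Lemma tuple_recursive_nil n : tuple_recursive (fun _ : n.-tuple nat => [tuple]).
Proof. by case. Qed.

Lemma tuple_recursive_cons n m (F : n.-tuple nat -> nat) (T : n.-tuple nat -> m.-tuple nat) :
  recursive F -> tuple_recursive T -> tuple_recursive (fun v => [tuple of F v :: T v]).
Proof.
move=> HF HT i; case: (unliftP ord0 i) => [j|] ->; last exact: eq_recursive HF.
by apply: eq_recursive (HT j) => v; rewrite tnthS.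
Qed.

Lemma tuple_recursive_behead n m (T : n.-tuple nat -> m.+1.-tuple nat) :
  tuple_recursive T -> tuple_recursive (fun v => [tuple of behead (T v)]).
Proof.
move=> HT i; apply: eq_recursive (HT (lift ord0 i)) => v.
by rewrite tnth_behead; congr tnth; apply: val_inj; rewrite /= inordK // ltnS.
Qed.

Lemma tuple_recursive_mktuple n m (H : 'I_m -> n.-tuple nat -> nat) :
  (forall i, recursive (H i)) -> tuple_recursive (fun v => [tuple H i v | i < m]).
Proof. by move=> HH i; apply: eq_recursive (HH i) => v; rewrite tnth_mktuple. Qed.

Lemma recursive_S n (F : n.-tuple nat -> nat) :
  recursive F -> recursive (fun v => (F v).+1).
Proof.
move=> HF; have HS : recursive (fun v : 1.-tuple nat => (thead v).+1) by exists MSucc.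
have := recursive_subst HS (tuple_recursive_cons HF (@tuple_recursive_nil n)).
by apply: eq_recursive => v; rewrite theadE.
Qed.

Lemma recursive_const n k : recursive (fun _ : n.-tuple nat => k).
Proof. by elim: k => [|k IHk]; [exists (MZero n) | apply: recursive_S]. Qed.

(** Primitive recursion, in the form in which the step function sees the counter,
the accumulator and the ambient variables. *)
Lemma recursive_iteri n (K G : n.-tuple nat -> nat) (H : n.+2.-tuple nat -> nat) :
  recursive K -> recursive G -> recursive H ->
  recursive (fun v => iteri (K v) (fun k z => H [tuple of k :: z :: v]) (G v)).
Proof.
move=> HK [g Hg] [h Hh].
have HR : recursive (fun v : n.+1.-tuple nat => let t := [tuple of behead v] in
    iteri (thead v) (fun k z => H [tuple of k :: z :: t]) (G t)).
  exists (MRec g h) => v /=; elim: (thead v) => [|k IHk] y /=; first exact: Hg.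
  split=> [[z [/IHk-> /Hh->]]|->] //.
  by eexists; split; [apply/IHk; reflexivity | apply/Hh].
have := recursive_subst HR (tuple_recursive_cons HK (@tuple_recursive_id n)).
apply: eq_recursive => v; rewrite theadE.
by have -> : [tuple of behead [tuple of K v :: v]] = v by apply: val_inj.
Qed.

(** A case distinction is an iteration whose step forgets the accumulator. *)
Lemma recursive_if0 n (B F G : n.-tuple nat -> nat) :
  recursive B -> recursive F -> recursive G ->
  recursive (fun v => if B v is 0 then F v else G v).
Proof.
move=> HB HF HG.
have HG' : recursive (fun w : n.+2.-tuple nat => G [tuple of behead [tuple of behead w]]).
  by apply: recursive_subst HG _; do 2!apply: tuple_recursive_behead; apply: tuple_recursive_id.
apply: eq_recursive (recursive_iteri HB HF HG') => v.
case: (B v) => //= k; congr G; exact: val_inj.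
Qed.

Lemma recursive_pred n (F : n.-tuple nat -> nat) :
  recursive F -> recursive (fun v => (F v).-1).
Proof.
move=> HF; have := recursive_iteri HF (recursive_const n 0) (recursive_proj ord0).
by apply: eq_recursive => v; case: (F v).
Qed.

(** In [recursive_iteri] the step function reads the tuple
[k :: z :: v]; this projection and the next one give access to the accumulator
[z] and to the variables [v]. *)
Lemma recursive_acc n : recursive (fun w : n.+2.-tuple nat => thead [tuple of behead w]).
Proof.
apply: eq_recursive (recursive_proj (lift ord0 ord0)) => w.
by case/tupleP: w => k w; case/tupleP: w => z w.
Qed.

Lemma tuple_recursive_env n :
  tuple_recursive (fun w : n.+2.-tuple nat => [tuple of behead [tuple of behead w]]).
Proof. by do 2!apply: tuple_recursive_behead; apply: tuple_recursive_id. Qed.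

Lemma recursive_iter n (K G F : n.-tuple nat -> nat) (op : nat -> nat -> nat) :
  recursive K -> recursive G -> recursive F ->
  recursive (fun w : 2.-tuple nat => op (tnth w ord0) (tnth w ord_max)) ->
  recursive (fun v => iter (K v) (op (F v)) (G v)).
Proof.
move=> HK HG HF Hop.
pose H (w : n.+2.-tuple nat) :=
  op (F [tuple of behead [tuple of behead w]]) (thead [tuple of behead w]).
have HH : recursive H.
  have HFw := recursive_subst HF (@tuple_recursive_env n).
  have := recursive_subst Hop (tuple_recursive_cons HFw
    (tuple_recursive_cons (@recursive_acc n) (@tuple_recursive_nil n.+2))).
  by apply: eq_recursive => w; congr op.
apply: eq_recursive (recursive_iteri HK HG HH) => v.
elim: (K v) => //= k ->; rewrite /H; congr (op (F _) _); exact: val_inj.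
Qed.

Lemma recursive_addn n (F G : n.-tuple nat -> nat) :
  recursive F -> recursive G -> recursive (fun v => F v + G v).
Proof.
move=> HF HG; apply: eq_recursive (recursive_iter (op := fun _ => S) HF HG HF _).
  by move=> v; elim: (F v) => //= k ->.
exact/recursive_S/recursive_proj.
Qed.

Lemma recursive_subn n (F G : n.-tuple nat -> nat) :
  recursive F -> recursive G -> recursive (fun v => F v - G v).
Proof.
move=> HF HG; apply: eq_recursive (recursive_iter (op := fun _ => predn) HG HF HF _).
  by move=> v; elim: (G v) => /= [|k ->]; rewrite ?subn0 ?subnS.
exact/recursive_pred/recursive_proj.
Qed.

Lemma recursive_muln n (F G : n.-tuple nat -> nat) :
  recursive F -> recursive G -> recursive (fun v => F v * G v).
Proof.
move=> HF HG.
apply: eq_recursive (recursive_iter (op := addn) HF (recursive_const n 0) HG _).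
  by move=> v; elim: (F v) => //= k ->; rewrite mulSn.
by apply: recursive_addn; apply: recursive_proj.
Qed.

Lemma recursive_expn n (F G : n.-tuple nat -> nat) :
  recursive F -> recursive G -> recursive (fun v => F v ^ G v).
Proof.
move=> HF HG.
apply: eq_recursive (recursive_iter (op := muln) HG (recursive_const n 1) HF _).
  by move=> v; elim: (G v) => //= k ->; rewrite expnS.
by apply: recursive_muln; apply: recursive_proj.
Qed.

Lemma recursive_prod n m (H : 'I_m -> n.-tuple nat -> nat) :
  (forall i, recursive (H i)) -> recursive (fun v => \prod_(i < m) H i v).
Proof.
elim: m H => [|m IHm] H HH.
  by apply: eq_recursive (recursive_const n 1) => v; rewrite big_ord0.
have := recursive_muln (HH ord0) (IHm (fun i => H (lift ord0 i)) (fun i => HH _)).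
by apply: eq_recursive => v; rewrite big_ord_recl.
Qed.

(** * Step-bounded evaluation *)

(** Evaluation of [p] with a budget: [E] applied to [s :: v] is [0] when the
budget [s] does not suffice, and [y.+1] when it suffices to find the value [y].
For a fixed program this is all that is needed of Kleene's normal form theorem,
and it can be built along the program without a universal machine.
Monotonicity in the budget allows the subprograms of a program to share one
budget. *)
Definition step_bounded n (p : murec n) (E : n.+1.-tuple nat -> nat) : Prop :=
  [/\ recursive E,
      forall s s' (v : n.-tuple nat) y, s <= s' ->
        E [tuple of s :: v] = y.+1 -> E [tuple of s' :: v] = y.+1
    & forall v y, murec_graph p v y <-> exists s, E [tuple of s :: v] = y.+1].

Lemma behead_cons_tuple n s (v : n.-tuple nat) :
  [tuple of behead [tuple of s :: v]] = v.
Proof. exact: val_inj. Qed.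

Lemma step_bounded_total n (p : murec n) (F : n.-tuple nat -> nat) :
  (forall v y, murec_graph p v y <-> y = F v) -> exists E, step_bounded p E.
Proof.
move=> Hp; exists (fun w : n.+1.-tuple nat => (F [tuple of behead w]).+1).
split=> [|s s' v y _|v y]; rewrite ?behead_cons_tuple //.
  apply/recursive_S/recursive_subst; first by exists p.
  exact/tuple_recursive_behead/tuple_recursive_id.
split=> [/Hp->|[s]]; first by exists 0; rewrite behead_cons_tuple.
by rewrite behead_cons_tuple => -[<-]; apply/Hp.
Qed.

Lemma recursive_thead n : recursive (fun w : n.+1.-tuple nat => thead w).
Proof. exact: recursive_proj. Qed.

(** The product of the results of the [h i] vanishes exactly when one of them
runs out of budget. *)
Lemma step_bounded_comp n m (g : murec m) (h : 'I_m -> murec n) Eg Eh :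
  step_bounded g Eg -> (forall i, step_bounded (h i) (Eh i)) ->
  exists E, step_bounded (MComp g h) E.
Proof.
move=> [Eg_rec Eg_mono EgP] Hh.
pose E (w : n.+1.-tuple nat) : nat :=
  if \prod_(i < m) Eh i w is 0 then 0
  else Eg [tuple of thead w :: [tuple (Eh i w).-1 | i < m]].
have EP s (v : n.-tuple nat) y : E [tuple of s :: v] = y.+1 <->
    exists u : m.-tuple nat, (forall i, Eh i [tuple of s :: v] = (tnth u i).+1)
      /\ Eg [tuple of s :: u] = y.+1.
  rewrite /E theadE; case Epr: (\prod_(i < m) _) => [|k].
    split=> // -[u [Hu _]].
    by have: 0 < \prod_(i < m) Eh i [tuple of s :: v];
      [apply: prodn_gt0 => i; rewrite Hu | rewrite Epr].
  have Ehi i : Eh i [tuple of s :: v] = (Eh i [tuple of s :: v]).-1.+1.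
    rewrite prednK // lt0n; apply/eqP => Ei0.
    by move: Epr; rewrite (bigD1 i) //= Ei0.
  split=> [Ey|[u [Hu <-]]].
    by exists [tuple (Eh i [tuple of s :: v]).-1 | i < m]; split=> // i; rewrite tnth_mktuple.
  congr (Eg _); apply: val_inj; congr cons; congr val.
  by apply: eq_from_tnth => i; rewrite tnth_mktuple Hu.
exists E; split=> [|s s' v y le_ss' /EP[u [Hu Eu]]|v y].
- apply: recursive_if0; last 1 first.
  + apply: recursive_subst Eg_rec _; apply: tuple_recursive_cons; first exact: recursive_thead.
    by apply: tuple_recursive_mktuple => i; apply: recursive_pred; have [] := Hh i.
  + by apply: recursive_prod => i; have [] := Hh i.
  + exact: recursive_const.
- apply/EP; exists u; split; last exact: Eg_mono Eu.
  by move=> i; have [_ Ehi_mono _] := Hh i; apply: Ehi_mono (Hu i).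
split=> /= [[u [Hu /EgP[s0 Es0]]]|[s /EP[u [Hu Eu]]]]; last first.
  by exists u; split=> [i|]; [have [_ _ ->] := Hh i; exists s | apply/EgP; exists s].
have /choice[t Ht] : forall i, exists s, Eh i [tuple of s :: v] = (tnth u i).+1.
  by move=> i; have [_ _ <-] := Hh i.
exists (maxn s0 (\max_(i < m) t i)); apply/EP; exists u; split; last first.
  exact: Eg_mono (leq_maxl _ _) Es0.
move=> i; have [_ Ehi_mono _] := Hh i; apply: Ehi_mono (Ht i).
by apply: leq_trans (leq_maxr _ _); apply: leq_bigmax.
Qed.

Lemma step_bounded_rec n (g : murec n) (h : murec n.+2) Eg Eh :
  step_bounded g Eg -> step_bounded h Eh -> exists E, step_bounded (MRec g h) E.
Proof.
move=> [Eg_rec Eg_mono EgP] [Eh_rec Eh_mono EhP].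
(* The budget is the first of the ambient variables, hence in position 2. *)
pose H (w : n.+4.-tuple nat) : nat :=
  let k := tnth w (inord 0) in let z := tnth w (inord 1) in let s := tnth w (inord 2) in
  let v := [tuple of behead (behead (behead (behead w)))] in
  if z is 0 then 0 else Eh [tuple of s :: k :: z.-1 :: v].
pose r s (t : n.-tuple nat) k :=
  iteri k (fun k z => if z is z.+1 then Eh [tuple of s :: k :: z :: t] else 0)
    (Eg [tuple of s :: t]).
pose E (w : n.+2.-tuple nat) :=
  r (thead w) [tuple of behead (behead w)] (thead [tuple of behead w]).
have E_cons s (v : n.+1.-tuple nat) :
    E [tuple of s :: v] = r s [tuple of behead v] (thead v).
  by rewrite /E theadE behead_cons_tuple; congr (r s _ _); apply: val_inj.
exists E.
have E_rec : recursive E.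
  have HH : recursive H.
    apply: recursive_if0; [exact: recursive_proj|exact: recursive_const|].
    apply: (recursive_subst Eh_rec).
    apply: tuple_recursive_cons; first exact: recursive_proj.
    apply: tuple_recursive_cons; first exact: recursive_proj.
    apply: tuple_recursive_cons; first exact/recursive_pred/recursive_proj.
    by do 4!apply: tuple_recursive_behead; apply: tuple_recursive_id.
  have HG : recursive (fun w : n.+2.-tuple nat =>
      Eg [tuple of thead w :: [tuple of behead [tuple of behead w]]]).
    apply: (recursive_subst Eg_rec); apply: tuple_recursive_cons.
      exact: recursive_thead.
    exact: tuple_recursive_env.
  have := recursive_iteri (recursive_acc n) HG HH.
  apply: eq_recursive => w; rewrite /E /r.
  elim: (thead [tuple of behead w]) => [|k IHk] /=; first by congr (Eg _); apply: val_inj.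
  rewrite IHk /H; set z := iteri k _ _.
  have -> : tnth [tuple of k :: z :: w] (inord 1) = z by rewrite (tnth_nth 0) inordK.
  case: z => // z; congr (Eh _); apply: val_inj => /=.
  by rewrite /thead !(tnth_nth 0) !inordK.
have r_mono s s' (t : n.-tuple nat) k y : s <= s' -> r s t k = y.+1 -> r s' t k = y.+1.
  move=> le_ss'; elim: k y => [|k IHk] y /=; first exact: Eg_mono.
  rewrite -!/(r _ _ _); case Ez: (r s t k) => [|z] //.
  by rewrite (IHk _ Ez); apply: Eh_mono.
split=> // [s s' v y le_ss'|v y].
  by rewrite !E_cons; apply: r_mono.
under [X in _ <-> X]eq_exists do rewrite E_cons.
rewrite /=; elim: (thead v) y => [|k IHk] y; first exact: EgP.
split=> [[z [/IHk[s1 E1] /EhP[s2 E2]]]|[s]].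
  exists (maxn s1 s2); rewrite /r iteriS -/(r _ _ _) (r_mono _ _ _ _ _ (leq_maxl _ _) E1).
  exact: Eh_mono (leq_maxr _ _) E2.
rewrite /r iteriS -/(r _ _ _); case Ez: (r s _ k) => [|z] // Ey.
by exists z; split; [apply/IHk; exists s | apply/EhP; exists s].
Qed.

(** The budget [s] bounds both the number of candidates and the evaluation of
each of them. *)
Lemma step_bounded_min n (g : murec n.+1) Eg :
  step_bounded g Eg -> exists E, step_bounded (MMin g) E.
Proof.
move=> [Eg_rec Eg_mono EgP].
(* The state of the search: 0 while no zero of [g] has been found, 1 when the
   search is stuck, [y.+2] once [y] is known to be the least zero. *)
pose next (s : nat) (v : n.-tuple nat) i z : nat :=
  if z is 0 then
    if Eg [tuple of s :: i :: v] is e.+1 then if e is 0 then i.+2 else 0 else 1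
  else z.
pose b s v k := iteri k (next s v) 0.
pose E (w : n.+1.-tuple nat) := (b (thead w) [tuple of behead w] (thead w)).-1.
exists E.
have E_cons s (v : n.-tuple nat) : E [tuple of s :: v] = (b s v s).-1.
  by rewrite /E theadE behead_cons_tuple.
have b0P s (v : n.-tuple nat) k : b s v k = 0 <->
    forall i, i < k -> exists z, Eg [tuple of s :: i :: v] = z.+2.
  elim: k => [|k IHk] /=; first by split.
  rewrite -/(b s v k) /next; split=> [|Hk].
    case Eb: (b s v k) => //; case Ee: (Eg _) => [|[|e]] // _ i.
    rewrite ltnS leq_eqVlt => /predU1P[->|]; first by exists e.
    exact: (IHk.1 Eb).
  have -> : b s v k = 0 by apply/IHk => i ltik; apply: Hk; apply: ltnW.
  by have [z ->] := Hk k (leqnn _).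
have bP s (v : n.-tuple nat) k y : b s v k = y.+2 <->
    [/\ y < k, Eg [tuple of s :: y :: v] = 1 & b s v y = 0].
  elim: k => [|k IHk] /=; first by split=> // -[].
  rewrite -/(b s v k) {1}/next; split=> [|[]].
    case Eb: (b s v k) => [|z] Ey; last first.
      by have [? ? ?] := IHk.1 (etrans Eb Ey); split=> //; apply: ltnW.
    by move: Ey; case Ee: (Eg _) => [|[|e]] // [<-]; split.
  rewrite ltnS leq_eqVlt => /predU1P[->|lt_yk] Ey b0; first by rewrite b0 Ey.
  by rewrite (IHk.2 _).
have EP s (v : n.-tuple nat) y : E [tuple of s :: v] = y.+1 <->
    [/\ y < s, Eg [tuple of s :: y :: v] = 1 &
        forall i, i < y -> exists z, Eg [tuple of s :: i :: v] = z.+2].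
  rewrite E_cons; split=> [Ey|[lt_ys Ey /b0P b0]].
    have /bP[lt_ys Es /b0P b0] : b s v s = y.+2 by case: (b s v s) Ey => //= k ->.
    by [].
  by have -> : b s v s = y.+2 by apply/bP.
have E_rec : recursive E.
  pose H (w : n.+3.-tuple nat) := next (thead [tuple of behead [tuple of behead w]])
    [tuple of behead (behead (behead w))] (thead w) (thead [tuple of behead w]).
  have HH : recursive H.
    have Hs : recursive (fun w : n.+3.-tuple nat => thead [tuple of behead [tuple of behead w]]).
      exact: recursive_subst (@recursive_thead n) (@tuple_recursive_env n.+1).
    have He : recursive (fun w : n.+3.-tuple nat =>
        Eg [tuple of thead [tuple of behead [tuple of behead w]] :: thead w ::
              behead (behead (behead w))]).
      apply: (recursive_subst Eg_rec); apply: tuple_recursive_cons => //.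
      apply: tuple_recursive_cons; first exact: recursive_thead.
      by do 3!apply: tuple_recursive_behead; apply: tuple_recursive_id.
    apply: recursive_if0; [exact: recursive_acc| |exact: recursive_acc].
    have := recursive_if0 He (recursive_const _ 1) (recursive_if0 (recursive_pred He)
       (recursive_S (recursive_S (@recursive_thead n.+2))) (recursive_const _ 0)).
    by apply: eq_recursive => w; case: (Eg _).
  have := recursive_pred (recursive_iteri (@recursive_thead n) (recursive_const _ 0) HH).
  apply: eq_recursive => w; rewrite /E /b; congr predn.
  apply: eq_iteri => k z; rewrite /H !theadE; congr (next _ _ _ _).
  + by case/tupleP: w.
  + exact: val_inj.
split=> // [s s' v y le_ss' /EP[lt_ys Ey Es]|v y].
  apply/EP; split; [exact: leq_trans le_ss'|exact: Eg_mono Ey|].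
  by move=> i /Es[z Ez]; exists z; apply: Eg_mono Ez.
split=> /= [[/EgP[s0 E0] Hy]|[s /EP[_ E0 Hy]]]; last first.
  by split=> [|i /Hy[z Ez]]; [apply/EgP; exists s | exists z; apply/EgP; exists s].
have /choice[t Ht] : forall i, exists s, i < y -> exists z, Eg [tuple of s :: i :: v] = z.+2.
  move=> i; have [lt_iy|] := boolP (i < y); last by exists 0.
  by have [z /EgP[s Es]] := Hy i lt_iy; exists s; exists z.
pose s := maxn y.+1 (maxn s0 (\max_(i < y) t i)).
exists s; apply/EP; split; first exact: leq_maxl.
  by apply: Eg_mono E0; rewrite leq_max leq_maxl orbT.
move=> i lt_iy; have [z Ez] := Ht i lt_iy; exists z; apply: Eg_mono Ez.
rewrite !leq_max; apply/orP; right; apply/orP; right.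
exact: (leq_bigmax (F := fun i : 'I_y => t i) (Ordinal lt_iy)).
Qed.

Lemma step_boundedP n (p : murec n) : exists E, step_bounded p E.
Proof.
elim: p => {n} [n||n i|n m g [Eg HEg] h Hh|n g [Eg HEg] h [Eh HEh]|n g [Eg HEg]].
- exact: (step_bounded_total (F := fun _ => 0)).
- exact: (step_bounded_total (F := fun v => (thead v).+1)).
- exact: (step_bounded_total (F := fun v => tnth v i)).
- by have [Eh HEh] := choice Hh; apply: step_bounded_comp HEg HEh.
- exact: step_bounded_rec HEg HEh.
- exact: step_bounded_min HEg.
Qed.

(** * Collatz-like systems *)

(** A generalized Collatz map on the positive numbers: with [N = q * m + r] and
[1 <= r <= m], the number [N] is replaced by [q * e + c], where [(e, c)] is the
entry of [r] in the table; [N] is final when there is no entry. Residues start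
at 1 so that a block of [r] letters is never empty, which keeps the grammar
below productive; [0 < c] keeps all numbers positive. *)
Record collatz := Collatz {
  modulus : nat;
  table : nat -> option (nat * nat);
  accepting : pred nat;
  modulus_gt0 : 0 < modulus;
  table_gt0 : forall r e c, table r = Some (e, c) -> 0 < c }.

Section Collatz.
Variable M : collatz.

(** Both functions are meant for positive [N] only. *)
Definition residue N := (N.-1 %% modulus M).+1.
Definition quotient N := N.-1 %/ modulus M.

Definition next N : option nat :=
  if table M (residue N) is Some (e, c) then Some (quotient N * e + c) else None.

Inductive run : nat -> bool -> Prop :=
| run_halt N : next N = None -> run N (accepting M (residue N))
| run_next N N' b : next N = Some N' -> run N' b -> run N b.

Lemma next_gt0 N N' : next N = Some N' -> 0 < N'.
Proof.
rewrite /next; case Et: (table _ _) => [[e c]|] // [<-].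
by rewrite addn_gt0 (table_gt0 Et) orbT.
Qed.

Lemma residue_bounds N : 0 < residue N <= modulus M.
Proof. by rewrite /= ltn_pmod // modulus_gt0. Qed.

Lemma quotient_residue N : 0 < N -> N = quotient N * modulus M + residue N.
Proof. by move=> N_gt0; rewrite addnS -divn_eq prednK. Qed.

Lemma residueMD q r : 0 < r <= modulus M -> residue (q * modulus M + r) = r.
Proof.
case: r => // r /andP[_ lt_rM].
by rewrite /residue addnS /= modnMDl modn_small.
Qed.

Lemma quotientMD q r : 0 < r <= modulus M -> quotient (q * modulus M + r) = q.
Proof.
case: r => // r /andP[_ lt_rM].
by rewrite /quotient addnS /= divnMDl ?divn_small ?addn0 // modulus_gt0.
Qed.

Lemma next_eq N r e d : residue N = r -> table M r = Some (e, d) ->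
  next N = Some (quotient N * e + d).
Proof. by rewrite /next => -> ->. Qed.

Lemma residue_shift N : 0 < N -> residue (modulus M + N) = residue N.
Proof. by case: N => // N _; rewrite /residue addnS /= modnDl. Qed.

Lemma quotient_shift N : 0 < N -> quotient (modulus M + N) = (quotient N).+1.
Proof.
by case: N => // N _; rewrite /quotient addnS /= divnDl ?dvdnn // divnn modulus_gt0.
Qed.

Lemma next_shift N e d : 0 < N -> table M (residue N) = Some (e, d) ->
  next (modulus M + N) = Some (e + (quotient N * e + d)).
Proof.
by move=> N_gt0 Et; rewrite /next residue_shift // Et quotient_shift // mulSn addnA.
Qed.

Lemma next_small r e d : 0 < r <= modulus M -> table M r = Some (e, d) -> next r = Some d.
Proof.
move=> Hr Et; have /= := @quotientMD 0 r Hr; have /= := @residueMD 0 r Hr.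
by rewrite mul0n add0n /next => -> ->; rewrite Et.
Qed.

Lemma residue_small r : 0 < r <= modulus M -> residue r = r.
Proof. by move=> Hr; rewrite -[r in LHS]add0n -(mul0n (modulus M)) residueMD. Qed.

(** The rules of the grammar for a residue class build its members in this way. *)
Lemma residue_ind (P : nat -> Prop) :
  (forall r, 0 < r <= modulus M -> P r) ->
  (forall N, 0 < N -> P N -> P (modulus M + N)) -> forall N, 0 < N -> P N.
Proof.
move=> Pr PS N N_gt0; rewrite (quotient_residue N_gt0).
elim: (quotient N) => [|q IHq]; first exact/Pr/residue_bounds.
by rewrite mulSn -addnA; apply: PS => //; rewrite addnS.
Qed.

End Collatz.

(** * Derivations in grammars *)

Section Derivations.
Variables (A : finType) (G : grammar A).
Implicit Types (x y s : seq (symbol A)) (w : seq A).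

Definition der s w : Prop := clos_refl_trans _ (derives1 G) s (map inl w).

Lemma derives1_cat u v x y : derives1 G x y -> derives1 G (u ++ x ++ v) (u ++ y ++ v).
Proof.
case=> u' [v' [p Gp [-> ->]]]; exists (u ++ u'), (v' ++ v), p => //.
by rewrite -!catA.
Qed.

Lemma der_cat s1 s2 w1 w2 : der s1 w1 -> der s2 w2 -> der (s1 ++ s2) (w1 ++ w2).
Proof.
move=> d1 d2; rewrite /der map_cat; apply: (rt_trans _ _ _ (map inl w1 ++ s2)).
  elim: d1 => [x y /(derives1_cat [::] s2)|x|x y z _ IHxy _ IHyz]; first exact: rt_step.
    exact: rt_refl.
  exact: rt_trans IHxy IHyz.
elim: d2 => [x y /(derives1_cat (map inl w1) [::])|x|x y z _ IHxy _ IHyz].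
- by rewrite !cats0; exact: rt_step.
- exact: rt_refl.
- exact: rt_trans IHxy IHyz.
Qed.

Lemma der_terminals w : der (map inl w) w.
Proof. exact: rt_refl. Qed.

Lemma der_letter c s w : der s w -> der (inl c :: s) (c :: w).
Proof. exact: (der_cat (der_terminals [:: c])). Qed.

Lemma der_production X s w : (X, s) \in G -> der s w -> der [:: inr X] w.
Proof.
move=> Gp; apply: rt_trans; apply: rt_step.
by exists [::], [::], (X, s) => //; rewrite cats0.
Qed.

(** The standard soundness argument: to bound the words that a grammar generates,
interpret each non-terminal by a language and check every production. *)
Variable L : nat -> seq A -> Prop.

Fixpoint denotes s w : Prop :=
  match s with
  | [::] => w = [::]
  | inl c :: s => exists2 w', w = c :: w' & denotes s w'
  | inr X :: s => exists w1 w2, [/\ w = w1 ++ w2, L X w1 & denotes s w2]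
  end.

Lemma denotes_cat s1 s2 w :
  denotes (s1 ++ s2) w <-> exists w1 w2, [/\ w = w1 ++ w2, denotes s1 w1 & denotes s2 w2].
Proof.
elim: s1 w => [|[c|X] s1 IHs] w /=.
- by split=> [d2|[_ [w2 [-> -> //]]]]; exists [::], w.
- split=> [[w' -> /IHs[w1 [w2 [-> d1 d2]]]]|[w1 [w2 [-> [w1' -> d1] d2]]]].
    by exists (c :: w1), w2; split=> //; exists w1.
  by exists (w1' ++ w2) => //; apply/IHs; exists w1', w2.
split=> [[w0 [w' [-> L0 /IHs[w1 [w2 [-> d1 d2]]]]]]|[w' [w2 [-> [w0 [w1 [-> L0 d1]]] d2]]]].
  by exists (w0 ++ w1), w2; split; rewrite ?catA //; exists w0, w1.
by exists w0, (w1 ++ w2); split; rewrite ?catA //; apply/IHs; exists w1, w2.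
Qed.

Lemma denotes_terminals w w' : denotes (map inl w) w' <-> w' = w.
Proof.
elim: w w' => [|c w IHw] w' //=; split=> [[u -> /IHw->]|->] //.
by exists w => //; apply/IHw.
Qed.

(** Read backwards, a derivation step turns the right-hand side of a production
into its non-terminal, so it preserves denotation. *)
Lemma denotes_derivation : (forall p, p \in G -> forall w, denotes p.2 w -> L p.1 w) ->
  forall X w, generates G X w -> L X w.
Proof.
move=> soundG X w; have: denotes (map inl w) w by apply/denotes_terminals.
suff dmono x y : clos_refl_trans _ (derives1 G) x y -> denotes y w -> denotes x w.
  move=> dw /dmono/(_ dw) /= [w1 [w2 [-> L1 ->]]]; by rewrite cats0.
elim=> // {x y} [x y|x y z _ IHxy _ IHyz /IHyz/IHxy //].
case=> u [v [p Gp [-> ->]]] /denotes_cat[w1 [w2 [-> d1 /denotes_cat[w3 [w4 [-> d3 d4]]]]]].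
apply/denotes_cat; exists w1, (w3 ++ w4); split=> //=.
by exists w3, w4; split=> //; apply: soundG d3.
Qed.

End Derivations.

(** * Histories *)

Section Histories.
Variables (A : eqType) (a : A) (M : collatz).
Implicit Types (x y z w H : seq A) (s : A).

(** The accepting histories of the run from [N]: the numbers of the run in unary,
each block closed by a separator, that is, by any letter other than [a].
Allowing all of these letters makes every word over the alphabet a sequence of
blocks, the last of which may lack its separator. *)
Inductive history : nat -> seq A -> Prop :=
| history_halt N s : s != a -> next M N = None -> accepting M (residue M N) ->
    history N (nseq N a ++ [:: s])
| history_next N N' s H : s != a -> next M N = Some N' -> history N' H ->
    history N (nseq N a ++ s :: H).

(** A block may begin after [x]. *)
Definition boundary x := (x == [::]) || (last a x != a).

Lemma block_inj i j s t x y : s != a -> t != a ->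
  nseq i a ++ s :: x = nseq j a ++ t :: y -> [/\ i = j, s = t & x = y].
Proof.
move=> sa ta; elim: i j => [|i IHi] [|j] /=.
- by case.
- by case=> Es; rewrite Es eqxx in sa.
- by case=> Es; rewrite -Es eqxx in ta.
- by case=> /IHi[-> -> ->].
Qed.

Lemma history_head N H : history N H -> exists s y, s != a /\ H = nseq N a ++ s :: y.
Proof. by case=> [{}N s sa _ _|{}N N' s {}H sa _ _]; exists s; eexists; split. Qed.

Lemma history_inv K N s y : s != a -> history K (nseq N a ++ s :: y) ->
  K = N /\ ([/\ next M N = None, accepting M (residue M N) & y = [::]]
            \/ exists2 N', next M N = Some N' & history N' y).
Proof.
move=> sa; move Ew: (_ ++ _) => w Hw; case: Hw Ew => [{}K t ta nK aK|{}K N' t H ta nK HN'].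
  by case/(block_inj sa ta)=> EN _ ->; subst N; split=> //; left; split.
by case/(block_inj sa ta)=> EN _ ->; subst N; split=> //; right; exists N'.
Qed.

Lemma boundary_block x N s : boundary x -> s != a -> boundary (x ++ nseq N a ++ [:: s]).
Proof. by move=> bx sa; rewrite /boundary catA last_cat /= sa orbT. Qed.

Lemma boundary_cat_block x N s y : boundary x -> s != a -> x != [::] ->
  forall z, x ++ z = nseq N a ++ s :: y ->
  exists2 x', boundary x' & x = nseq N a ++ s :: x' /\ x' ++ z = y.
Proof.
move=> bx sa x0 z; have {bx x0} : last a x != a by case: x bx x0.
elim: N x => [|N IHN] [|c x] /=; rewrite ?eqxx //.
  move=> lx [Ec Ey]; subst c; exists x => //; rewrite /boundary.
  by case: x lx {Ey} => //= c x ->.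
move=> lx [Ec /IHN]; subst c; case=> [|x' bx' [-> <-]] //.
by exists x'.
Qed.

(** A history cut at a block boundary is the history of a later number; hence an
error between two adjacent blocks rules out a history wherever it occurs. *)
Lemma history_suffix N x z : boundary x -> z != [::] -> history N (x ++ z) ->
  exists K, history K z.
Proof.
move Ew: (x ++ z) => w bx z0 Hw.
elim: Hw x bx Ew => {N w} [N s sa nN aN|N N' s H sa nN HN' IH] x bx.
  case: (eqVneq x [::]) => [-> /= ->|x0]; first by exists N; apply: history_halt.
  case/(boundary_cat_block bx sa x0)=> x' _ [_ /eqP].
  by rewrite -size_eq0 size_cat addn_eq0 !size_eq0 (negPf z0) andbF.
case: (eqVneq x [::]) => [-> /= ->|x0]; first by exists N; apply: history_next nN HN'.
by case/(boundary_cat_block bx sa x0)=> x' bx' [_ /IH]; apply.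
Qed.

Lemma history_last N H : history N H -> last a H != a.
Proof.
elim=> {N H} [N s sa _ _|N N' s H sa _ HN' IH]; rewrite last_cat //=.
by case: H HN' IH => [|//] /history_head[? [? [_]]]; case: N'.
Qed.

(** The first block of [u] is too short, or already too long, for the number [N];
no continuation of [u] can repair this. *)
Definition mismatch N u : Prop :=
  (exists i s y, [/\ i < N, s != a & u = nseq i a ++ s :: y]) \/
  (exists y, u = nseq N.+1 a ++ y).

Lemma mismatch_cat N u v : mismatch N u -> mismatch N (u ++ v).
Proof.
case=> [[i [t [z [lt_iN ta ->]]]]|[z ->]]; rewrite -catA.
  by left; exists i, t, (z ++ v).
by right; exists (z ++ v).
Qed.

Lemma history_mismatch N w : history N w -> ~ mismatch N w.
Proof.
move/history_head=> [s [y [sa ->]]] [[i [t [z [lt_iN ta]]]]|[z]].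
  by case/(block_inj sa ta)=> Ei _ _; rewrite Ei ltnn in lt_iN.
elim: N => [|N IHN] /= [] //.
by move=> Es; rewrite Es eqxx in sa.
Qed.

Lemma first_block u :
  (exists i s y, s != a /\ u = nseq i a ++ s :: y) \/ u = nseq (size u) a.
Proof.
elim: u => [|c u IHu]; first by right.
have [->|ca] := eqVneq c a; last by left; exists 0, c, u.
case: IHu => [[i [s [y [sa ->]]]]|Eu]; first by left; exists i.+1, s, y.
by right; rewrite /= -Eu.
Qed.

(** The three ways in which a word can relate to an expected block [N]. *)
Lemma block_cases N u :
  [\/ exists s y, s != a /\ u = nseq N a ++ s :: y, mismatch N u
    | exists2 i, i <= N & u = nseq i a].
Proof.
case: (first_block u) => [[i [s [y [sa Eu]]]]|Eu].
  have [lt_iN|lt_Ni|Ei] := ltngtP i N.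
  - by apply: Or32; left; exists i, s, y.
  - apply: Or32; right; exists (nseq (i - N.+1) a ++ s :: y).
    by rewrite Eu -[in LHS](subnKC lt_Ni) nseqD -catA.
  - by apply: Or31; exists s, y; rewrite -Ei.
case: (leqP (size u) N) => [le_uN|lt_Nu]; first by apply: Or33; exists (size u).
apply: Or32; right; exists (nseq (size u - N.+1) a).
by rewrite {1}Eu -nseqD subnKC.
Qed.

Lemma run_history N s : s != a -> run M N true -> exists H, history N H.
Proof.
move=> sa; move Eb: true => b HN; elim: HN Eb => {N b} [N nN|N N' b nN _ IH] Eb.
  by exists (nseq N a ++ [:: s]); apply: history_halt; rewrite // -Eb.
by have [H HH] := IH Eb; exists (nseq N a ++ s :: H); apply: history_next nN HH.
Qed.

End Histories.

(** * The grammar of a run *)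

(** The non-terminals. [Start], [Cut] and [Any] are the symbols S, Y and T of
regular totality. [Cut] generates words that are not prefixes of accepting
histories. [Sep] is a separator. [Head] generates first blocks that are wrong for
the initial number. [Block r] generates the blocks of the numbers [N] with residue
[r]; [Long r] and [Short r] generate the block of such an [N] followed by the whole
block of [next N], or by a proper part of it, so that one more [a], or a separator,
makes the pair wrong. *)
Inductive role := Start | Cut | Any | Sep | Head | Long of nat | Short of nat | Block of nat.

Definition role_code (X : role) : nat :=
  match X with
  | Start => start | Cut => 1 | Any => 2 | Sep => 3 | Head => 4
  | Long r => 5 + r * 3 | Short r => 6 + r * 3 | Block r => 7 + r * 3
  end.

Lemma role_code_inj : injective role_code.
Proof.
case=> [|||||r|r|r] [|||||r'|r'|r'] //=; rewrite /start => E; try congr (_ _); lia.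
Qed.

Section Grammar.
Variables (A : finType) (a : A) (M : collatz).
Implicit Types (c s : A) (u v w x y : seq A) (p : production A).

Definition var (X : role) : symbol A := inr (role_code X).
Definition letter c : symbol A := inl c.
Definition letters : seq A := enum A.
Definition separators : seq A := [seq s <- enum A | s != a].
Definition block k : seq (symbol A) := map letter (nseq k a).
Definition residues : seq nat := iota 1 (modulus M).

Definition moving : seq (nat * (nat * nat)) :=
  pmap (fun r => omap (pair r) (table M r)) residues.
Definition halting : seq nat := [seq r <- residues | table M r == None].
Definition refusing : seq nat :=
  [seq r <- residues | ~~ ((table M r == None) && accepting M r)].

(** A production must contain a terminal, so the empty word is not available as a
right-hand side. Optional contexts are therefore expanded: [prefixes] lists the
ways to write a word that ends at a block boundary, [suffixes] the ways to write an
arbitrary word. Both lists are locked, to prevent simplification from multiplying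
out the productions. *)
Definition prefixes : seq (seq (symbol A)) :=
  locked [:: [::]; [:: var Sep]; [:: var Any; var Sep]].
Definition suffixes : seq (seq (symbol A)) := locked [:: [::]; [:: var Any]].

Lemma mem_prefixes l :
  (l \in prefixes) = [|| l == [::], l == [:: var Sep] | l == [:: var Any; var Sep]].
Proof. by rewrite /prefixes -lock !inE. Qed.

Lemma mem_suffixes l : (l \in suffixes) = (l == [::]) || (l == [:: var Any]).
Proof. by rewrite /suffixes -lock !inE. Qed.

Definition rule (X : role) (rhs : seq (symbol A)) : production A := (role_code X, rhs).

Definition start_rules : grammar A :=
  [seq rule Start (letter c :: rhs) | c <- letters,
     rhs <- [:: [::]; [:: var Cut; var Any]; [:: var Cut]; [:: var Head];
                [:: letter a]; [:: var Any; letter a]]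
            ++ [seq l ++ [:: var (Block r); var Sep] | l <- prefixes, r <- refusing]].

Definition any_rules : grammar A :=
  [seq rule Any (letter c :: rhs) | c <- letters, rhs <- suffixes].

Definition sep_rules : grammar A := [seq rule Sep [:: letter s] | s <- separators].

Definition cut_rules : grammar A :=
  [seq rule Cut (rhs ++ l) | rhs <- [seq [:: var Head; letter c] | c <- letters]
     ++ [seq l ++ [:: var (Long t.1); letter a] | l <- prefixes, t <- moving]
     ++ [seq l ++ rhs | l <- prefixes,
           rhs <- [seq [:: var (Short t.1); letter s] | t <- moving, s <- separators]],
     l <- suffixes]
  ++ [seq rule Cut (l ++ rhs) | l <- prefixes,
        rhs <- [seq [:: var (Block r); letter s; var Any] | r <- halting, s <- separators]].

Definition long_rules : grammar A := flatten
  [seq [:: rule (Long t.1) (block (modulus M) ++ var (Long t.1) :: block t.2.1);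
           rule (Long t.1) (block t.1 ++ var Sep :: block t.2.2)] | t <- moving].

Definition short_rules : grammar A := flatten
  [seq [seq rule (Short t.1) (block (modulus M) ++ var (Short t.1) :: block j)
          | j <- iota 0 t.2.1.+1]
       ++ [seq rule (Short t.1) (block t.1 ++ var Sep :: block j)
          | j <- iota 0 t.2.2] | t <- moving].

Definition block_rules : grammar A := flatten
  [seq [:: rule (Block r) (block (modulus M) ++ [:: var (Block r)]);
           rule (Block r) (block r)] | r <- residues].

Definition common_rules : grammar A :=
  [seq rule Head [:: letter s] | s <- separators]
  ++ start_rules ++ any_rules ++ sep_rules ++ cut_rules
  ++ long_rules ++ short_rules ++ block_rules.

(** The rules for first blocks of length [1] to [k], in front of the common rules:
with [head_long] these are the only rules that depend on the initial number [n],
and the recursion on [k] shows that the code of the grammar is computable from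
[n]. *)
Fixpoint short_heads k : grammar A :=
  if k is k'.+1 then rule Head (block k ++ [:: var Sep]) :: short_heads k' else common_rules.

Definition run_grammar n : grammar A :=
  rule Head (block n.+1) :: short_heads n.-1.

(** The productions of [run_grammar n], without the bookkeeping of lists. A word
generated by [Start] has an arbitrary first letter [c]; the remaining word fails to be
an accepting history because it is empty ([start_letter]), because it has a wrong
prefix ([start_cut], [start_cut_any], [start_head]), because its last block is not
closed ([start_open], [start_any_open]), or because it ends with the block of a number
at which the run does not stop and accept ([start_refuse]). *)
Inductive run_rule n : role -> seq (symbol A) -> Prop :=
| head_long : run_rule n Head (block n.+1)
| head_short k of 0 < k < n : run_rule n Head (block k ++ [:: var Sep])
| head_sep s of s != a : run_rule n Head [:: letter s]
| start_letter c : run_rule n Start [:: letter c]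
| start_cut_any c : run_rule n Start [:: letter c; var Cut; var Any]
| start_cut c : run_rule n Start [:: letter c; var Cut]
| start_head c : run_rule n Start [:: letter c; var Head]
| start_open c : run_rule n Start [:: letter c; letter a]
| start_any_open c : run_rule n Start [:: letter c; var Any; letter a]
| start_refuse c l r of l \in prefixes & 0 < r <= modulus M
    & ~~ ((table M r == None) && accepting M r) :
    run_rule n Start (letter c :: l ++ [:: var (Block r); var Sep])
| any_rule c l of l \in suffixes : run_rule n Any (letter c :: l)
| sep_rule s of s != a : run_rule n Sep [:: letter s]
| cut_head c l of l \in suffixes : run_rule n Cut ([:: var Head; letter c] ++ l)
| cut_long r t l' l of l' \in prefixes & 0 < r <= modulus M & table M r = Some t
    & l \in suffixes :
    run_rule n Cut ((l' ++ [:: var (Long r); letter a]) ++ l)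
| cut_short r t s l' l of l' \in prefixes & 0 < r <= modulus M & table M r = Some t
    & s != a & l \in suffixes :
    run_rule n Cut ((l' ++ [:: var (Short r); letter s]) ++ l)
| cut_halt r s l' of l' \in prefixes & 0 < r <= modulus M & table M r = None & s != a :
    run_rule n Cut (l' ++ [:: var (Block r); letter s; var Any])
| long_step r e d of 0 < r <= modulus M & table M r = Some (e, d) :
    run_rule n (Long r) (block (modulus M) ++ var (Long r) :: block e)
| long_base r e d of 0 < r <= modulus M & table M r = Some (e, d) :
    run_rule n (Long r) (block r ++ var Sep :: block d)
| short_step r e d j of 0 < r <= modulus M & table M r = Some (e, d) & j <= e :
    run_rule n (Short r) (block (modulus M) ++ var (Short r) :: block j)
| short_base r e d j of 0 < r <= modulus M & table M r = Some (e, d) & j < d :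
    run_rule n (Short r) (block r ++ var Sep :: block j)
| block_step r of 0 < r <= modulus M :
    run_rule n (Block r) (block (modulus M) ++ [:: var (Block r)])
| block_base r of 0 < r <= modulus M : run_rule n (Block r) (block r).

Lemma movingP t : t \in moving <-> 0 < t.1 <= modulus M /\ table M t.1 = Some t.2.
Proof.
rewrite mem_pmap; split=> [/mapP[r]|[r_bd Et]].
  by rewrite mem_iota add1n ltnS; case Et: (table M r) => [t'|] // r_bd [->].
by apply/mapP; exists t.1; rewrite ?mem_iota ?add1n ?ltnS ?Et //; case: t {Et r_bd}.
Qed.

Lemma mem_letters c : c \in letters.
Proof. exact: mem_enum. Qed.

Lemma mem_separators s : (s \in separators) = (s != a).
Proof. by rewrite mem_filter mem_enum andbT. Qed.

Lemma mem_residues r : (r \in residues) = (0 < r <= modulus M).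
Proof. by rewrite mem_iota add1n ltnS. Qed.

Lemma short_headsP n k p : k < n ->
  p \in short_heads k -> p \in common_rules \/
    exists2 rhs, p = rule Head rhs & run_rule n Head rhs.
Proof.
elim: k => [|k IHk] /= lt_kn; first by left.
rewrite inE => /predU1P[->|]; last exact/IHk/ltnW.
by right; exists (block k.+1 ++ [:: var Sep]) => //; apply: head_short.
Qed.

Lemma run_grammar_inv n p : 0 < n -> p \in run_grammar n ->
  exists2 X, p.1 = role_code X & run_rule n X p.2.
Proof.
move=> n_gt0; rewrite inE => /predU1P[->|]; first by exists Head => //; apply: head_long.
have lt_n : n.-1 < n by rewrite prednK.
case/(short_headsP lt_n) => [|[rhs -> Hrhs]]; last by exists Head.
rewrite !mem_cat => /orP[/mapP[s]|].
  by rewrite mem_separators => sa ->; exists Head => //; apply: head_sep.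
case/orP=> [/allpairsP[[c rhs] /= [_]]|].
  rewrite !inE => Hrhs ->; exists Start => //=.
  do 6?[case/predU1P: Hrhs => [->|Hrhs]; first by constructor].
  case/allpairsP: Hrhs => [[l r] [Hl]].
  by rewrite mem_filter mem_residues => /andP[Hr1 Hr2] ->; apply: start_refuse.
case/orP=> [/allpairsP[[c l] /= [_ Hl ->]]|]; first by exists Any => //; apply: any_rule.
case/orP=> [/mapP[s]|].
  by rewrite mem_separators => sa ->; exists Sep => //; apply: sep_rule.
case/orP=> [|].
  case/orP=> [/allpairsP[[rhs l] /= [Hrhs Hl ->]]|/allpairsP[[l rhs] /= [Hl]]].
    exists Cut => //=; move: Hrhs; rewrite !mem_cat => /or3P[/mapP[c _ ->]||].
    - exact: cut_head.
    - by case/allpairsP=> [[l' t] /= [Hl' /movingP[Hr Et] ->]]; apply: cut_long Et _.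
    case/allpairsP=> [[l' rhs'] /= [Hl' /allpairsP[[t s] /= [/movingP[Hr Et]]]]].
    by rewrite mem_separators => sa -> ->; apply: cut_short Et _ _.
  case/allpairsP=> [[r s] /= []]; rewrite mem_filter mem_separators mem_residues.
  by case/andP=> /eqP Er Hr sa -> ->; exists Cut => //=; apply: cut_halt.
case/or3P=> [/flatten_mapP[[r [e d]] /movingP[Hr Et]]
  |/flatten_mapP[[r [e d]] /movingP[Hr Et]]|].
- rewrite !inE => /orP[/eqP->|/eqP->]; exists (Long r) => //=; first exact: long_step Et.
  exact: long_base Et.
- rewrite mem_cat => /orP[/mapP[j]|/mapP[j]]; rewrite mem_iota add0n => /= Hj ->.
    by exists (Short r) => //; apply: short_step Et _.
  by exists (Short r) => //; apply: short_base Et _.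
case/flatten_mapP=> r; rewrite mem_residues => Hr.
by rewrite !inE => /orP[/eqP->|/eqP->]; exists (Block r) => //=; constructor.
Qed.

Lemma sub_short_heads k : {subset common_rules <= short_heads k}.
Proof. by elim: k => //= k IHk p /IHk Gp; rewrite inE Gp orbT. Qed.

Lemma mem_short_heads j k :
  0 < j <= k -> rule Head (block j ++ [:: var Sep]) \in short_heads k.
Proof.
elim: k => [|k IHk] /=; first by case: j.
rewrite (leq_eqVlt j) ltnS inE; case: eqVneq => [->|_] /=; first by rewrite eqxx.
by move/IHk->; rewrite orbT.
Qed.

Lemma run_rule_mem n X rhs : 0 < n -> run_rule n X rhs -> rule X rhs \in run_grammar n.
Proof.
move=> n_gt0 HX; rewrite /run_grammar inE.
have sub p : p \in common_rules ->
    (p == rule Head (block n.+1)) || (p \in short_heads n.-1).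
  by move/sub_short_heads->; rewrite orbT.
have in_start c rhs0 Hrhs : rule Start (letter c :: rhs0) \in start_rules :=
  allpairs_f (fun c rhs => rule Start (letter c :: rhs)) (mem_letters c) Hrhs.
have in_long r t : 0 < r <= modulus M -> table M r = Some t -> (r, t) \in moving.
  by move=> Hr Et; apply/movingP.
have in_cut rhs0 l : rhs0 \in [seq [:: var Head; letter c] | c <- letters]
     ++ [seq l ++ [:: var (Long t.1); letter a] | l <- prefixes, t <- moving]
     ++ [seq l ++ rhs | l <- prefixes,
           rhs <- [seq [:: var (Short t.1); letter s] | t <- moving, s <- separators]] ->
     l \in suffixes -> rule Cut (rhs0 ++ l) \in cut_rules.
  move=> Hrhs Hl; rewrite mem_cat; apply/orP; left.
  exact: (allpairs_f (fun rhs l => rule Cut (rhs ++ l))).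
have s_start p : p \in start_rules -> p \in common_rules.
  by move=> Hp; rewrite !mem_cat Hp !orbT.
have s_cut p : p \in cut_rules -> p \in common_rules.
  by rewrite mem_cat => Hp; rewrite !mem_cat Hp !orbT.
case: HX => {X rhs}.
- by rewrite eqxx.
- by move=> k /andP[k0 ltkn]; rewrite mem_short_heads ?orbT // k0 -ltnS prednK.
- move=> s sa; apply: sub; rewrite mem_cat; apply/orP; left.
  by apply/mapP; exists s; rewrite ?mem_separators.
- by move=> c; apply/sub/s_start/in_start.
- by move=> c; apply/sub/s_start/in_start.
- by move=> c; apply/sub/s_start/in_start.
- by move=> c; apply/sub/s_start/in_start.
- by move=> c; apply/sub/s_start/in_start; rewrite !inE eqxx !orbT.
- by move=> c; apply/sub/s_start/in_start; rewrite !inE eqxx !orbT.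
- move=> c l r Hl r_bd r_ref; apply/sub/s_start/in_start; rewrite mem_cat; apply/orP; right.
  apply/allpairsP; exists (l, r); split=> //.
  by rewrite mem_filter r_ref mem_residues.
- move=> c l Hl; apply: sub; rewrite 3!mem_cat; apply/or4P/Or43.
  by apply/allpairsP; exists (c, l); rewrite mem_letters.
- move=> s sa; apply: sub; rewrite 4!mem_cat; apply/orP; right; apply/or4P/Or43.
  by apply/mapP; exists s; rewrite ?mem_separators.
- move=> c l Hl; apply/sub/s_cut/in_cut => //; rewrite mem_cat; apply/orP; left.
  by apply/mapP; exists c; rewrite ?mem_letters.
- move=> r t l' l Hl' Hr Et Hl; apply/sub/s_cut/in_cut => //.
  rewrite 2!mem_cat; apply/or3P/Or32.
  by apply/allpairsP; exists (l', (r, t)); rewrite in_long.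
- move=> r t s l' l Hl' Hr Et sa Hl; apply/sub/s_cut/in_cut => //.
  rewrite 2!mem_cat; apply/or3P/Or33.
  apply/allpairsP; exists (l', [:: var (Short r); letter s]); split=> //=.
  by apply/allpairsP; exists ((r, t), s); rewrite in_long // mem_separators.
- move=> r s l' Hl' Hr Er sa; apply/sub/s_cut; rewrite mem_cat; apply/orP; right.
  apply/allpairsP; exists (l', [:: var (Block r); letter s; var Any]); split=> //=.
  by apply/allpairsP; exists (r, s); rewrite mem_filter Er eqxx mem_residues mem_separators.
all: move=> r.
- move=> e d Hr Et; apply: sub; do 5![rewrite mem_cat; apply/orP; right].
  rewrite 2!mem_cat; apply/or3P/Or31.
  by apply/flatten_mapP; exists (r, (e, d)); rewrite ?in_long // !inE eqxx.
- move=> e d Hr Et; apply: sub; do 5![rewrite mem_cat; apply/orP; right].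
  rewrite 2!mem_cat; apply/or3P/Or31.
  by apply/flatten_mapP; exists (r, (e, d)); rewrite ?in_long // !inE eqxx orbT.
- move=> e d j Hr Et Hj; apply: sub; do 5![rewrite mem_cat; apply/orP; right].
  rewrite 2!mem_cat; apply/or3P/Or32.
  apply/flatten_mapP; exists (r, (e, d)); rewrite ?in_long // mem_cat; apply/orP; left.
  by apply/mapP; exists j; rewrite ?mem_iota.
- move=> e d j Hr Et Hj; apply: sub; do 5![rewrite mem_cat; apply/orP; right].
  rewrite 2!mem_cat; apply/or3P/Or32.
  apply/flatten_mapP; exists (r, (e, d)); rewrite ?in_long // mem_cat; apply/orP; right.
  by apply/mapP; exists j; rewrite ?mem_iota.
- move=> Hr; apply: sub; do 5![rewrite mem_cat; apply/orP; right].
  rewrite 2!mem_cat; apply/or3P/Or33.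
  by apply/flatten_mapP; exists r; rewrite ?mem_residues // !inE eqxx.
- move=> Hr; apply: sub; do 5![rewrite mem_cat; apply/orP; right].
  rewrite 2!mem_cat; apply/or3P/Or33.
  by apply/flatten_mapP; exists r; rewrite ?mem_residues // !inE eqxx orbT.
Qed.

End Grammar.

(** * The language of the grammar *)

Section Languages.
Variables (A : finType) (a : A) (M : collatz) (n : nat).
Hypothesis n_gt0 : 0 < n.
Implicit Types (c s : A) (u v w x y H : seq A).
Local Notation G := (run_grammar a M n).
Local Notation history := (history a M).

(** Upper bounds for the generated languages. Only those of [Start] and [Cut]
matter in the end, and they refer to the single number [n]: a word is excluded from
[Cut] when it is a prefix of an accepting history. *)
Definition meaning (X : role) w : Prop :=
  match X with
  | Start => forall c H, history n H -> w <> c :: H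
  | Cut => forall v, ~ history n (w ++ v)
  | Any => w != [::]
  | Sep => exists2 s, s != a & w = [:: s]
  | Head => mismatch a n w
  | Long r => exists N N' s,
      [/\ 0 < N /\ residue M N = r, next M N = Some N', s != a
        & w = nseq N a ++ s :: nseq N' a]
  | Short r => exists N N' m s,
      [/\ 0 < N /\ residue M N = r, next M N = Some N', m < N', s != a
        & w = nseq N a ++ s :: nseq m a]
  | Block r => exists2 N, 0 < N /\ residue M N = r & w = nseq N a
  end.

Definition language (X : nat) w : Prop := forall X', X = role_code X' -> meaning X' w.

Local Notation denotes := (denotes language).

Lemma language_role X w : language (role_code X) w <-> meaning X w.
Proof. by split=> [|HX X' /role_code_inj<-]; [apply | ]. Qed.

Lemma denotes_var X w : denotes [:: var A X] w -> meaning X w.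
Proof. by case=> w1 [w2 [-> /language_role HX ->]]; rewrite cats0. Qed.

Lemma denotes_prefix l x : l \in prefixes A -> denotes l x -> boundary a x.
Proof.
rewrite mem_prefixes => /or3P[/eqP->|/eqP->|/eqP->] /=; first by move->.
  by case=> w1 [_ [-> /(language_role Sep) [s sa ->] ->]]; rewrite /boundary /= sa.
case=> x1 [_ [-> _ [_ [_ [-> /(language_role Sep) [s sa ->] ->]]]]].
by rewrite /boundary last_cat /= sa orbT.
Qed.

Lemma denotes_block k rhs w : denotes (block a k ++ rhs) w ->
  exists2 y, w = nseq k a ++ y & denotes rhs y.
Proof. by case/denotes_cat=> w1 [y [-> /denotes_terminals-> Hy]]; exists y. Qed.

Lemma denotes_blockE k w : denotes (block a k) w -> w = nseq k a.
Proof. by rewrite -[block a k]cats0 => /denotes_block[y -> ->]; rewrite cats0. Qed.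

(** Where a history has a complete block [N], it either stops there and accepts or
goes on with a history of [next N]; the soundness of the rules for [Cut] and
[Start] contradicts this alternative. *)
Lemma history_at x N s y : boundary a x -> s != a -> history n (x ++ nseq N a ++ s :: y) ->
  [/\ next M N = None, accepting M (residue M N) & y = [::]]
  \/ exists2 N', next M N = Some N' & history N' y.
Proof.
move=> bx sa /(history_suffix bx); case; first by case: N.
by move=> K /(history_inv sa)[<-].
Qed.

Lemma run_rule_sound X rhs w : run_rule a M n X rhs -> denotes rhs w -> meaning X w.
Proof.
case=> {X rhs}.
- by move/denotes_blockE->; right; exists [::]; rewrite cats0.
- move=> k /andP[_ lt_kn] /denotes_block[y -> /(denotes_var (X := Sep))[s sa ->]].
  by left; exists k, s, [::].
- by move=> s sa [? -> ->]; left; exists 0, s, [::].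
- move=> c [? -> ->] c' H HH [? EH]; move: HH; rewrite -EH => /history_head[s [y [_]]].
  by case: n.
- move=> c [? -> [u [u2 [-> /(language_role Cut) Hu /(denotes_var (X := Any)) _]]]].
  by move=> c' H HH [? EH]; rewrite -EH in HH; apply: Hu HH.
- move=> c [? -> /(denotes_var (X := Cut)) Hu] c' H HH [? EH].
  by apply: (Hu [::]); rewrite cats0 EH.
- move=> c [? -> /(denotes_var (X := Head)) Hu] c' H HH [? EH].
  by rewrite -EH in HH; apply: history_mismatch HH Hu.
- move=> c [? -> [? -> ->]] c' H /history_last + [? EH].
  by rewrite -EH /= eqxx.
- move=> c [? -> [u [u2 [-> _ [? -> ->]]]]] c' H /history_last + [? EH].
  by rewrite -EH last_cat /= eqxx.
- move=> c l r Hl Hr Hacc [? -> /denotes_cat[x [u3 [-> /(denotes_prefix Hl) bx]]]].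
  case=> u1 [u2 [-> /(language_role (Block r)) + /(denotes_var (X := Sep)) [s sa ->]]].
  case=> [N [N_gt0 Er] ->].
  move=> c' H HH [? EH]; rewrite -EH in HH.
  case: (history_at bx sa HH) => [[nN aN _]|[N' _ /history_head[? [? [_]]]]]; last by case: N'.
  move: nN aN Hacc; rewrite /next Er; case: (table M r) => [[]|] // _ ->.
  by rewrite eqxx.
- by move=> c l _ [? -> _].
- by move=> s sa [? -> ->]; exists s.
- move=> c l _ [u [u2 [-> /(language_role Head) Hu _]]] v.
  by rewrite -catA => /history_mismatch; apply; apply: mismatch_cat.
- move=> r t l' l Hl' Hr Et _ /denotes_cat[u0 [y [->]]].
  move=> /denotes_cat[x [u3 [-> /(denotes_prefix Hl') bx]]].
  case=> u1 [u2 [-> /(language_role (Long r)) [N [N' [s [[N_gt0 Er] nN sa ->]]]] [? -> ->]]] _ v.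
  rewrite -!catA /= => /(history_at bx sa) [[]|[N'']]; first by rewrite nN.
  rewrite nN => -[<-] /history_mismatch; apply; right; exists (y ++ v).
  by elim: N' {nN} => //= N' ->.
- move=> r t s' l' l Hl' Hr Et s'a _ /denotes_cat[u0 [y [->]]].
  move=> /denotes_cat[x [u3 [-> /(denotes_prefix Hl') bx]]].
  case=> u1 [u2 [-> /(language_role (Short r)) + [? -> ->]]] _ v.
  case=> [N [N' [m [s [[N_gt0 Er] nN lt_mN' sa ->]]]]].
  rewrite -!catA /= => /(history_at bx sa) [[]|[N'']]; first by rewrite nN.
  rewrite nN => -[<-] /history_mismatch; apply; left.
  by exists m, s', (y ++ v).
- move=> r s l' Hl' Hr Et sa /denotes_cat[x [u3 [-> /(denotes_prefix Hl') bx]]].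
  case=> u1 [u2 [-> /(language_role (Block r)) + [? -> /(denotes_var (X := Any)) y0]]] v.
  case=> [N [N_gt0 Er] ->].
  rewrite -!catA /= => /(history_at bx sa) [[_ _ /eqP]|[N'']].
    by rewrite -size_eq0 size_cat addn_eq0 !size_eq0 (negPf y0).
  by rewrite /next Er Et.
- move=> r e d Hr Et /denotes_block[u0 ->].
  case=> u1 [u2 [-> /(language_role (Long r)) + /denotes_blockE->]].
  case=> [N [N' [s [[N_gt0 Er] nN sa ->]]]]; rewrite -Er in Et.
  exists (modulus M + N), (N' + e), s; rewrite residue_shift // addn_gt0 N_gt0 orbT.
  split=> //; last by rewrite nseqD -!catA /= nseqD.
  by rewrite (next_shift N_gt0 Et) addnC; move: nN; rewrite /next Et => -[->].
- move=> r e d Hr Et /denotes_block[u0 ->].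
  case=> u1 [u2 [-> /(language_role Sep) [s sa ->] /denotes_blockE->]].
  by exists r, d, s; rewrite residue_small // (next_small Hr Et); case/andP: Hr.
- move=> r e d j Hr Et Hj /denotes_block[u0 ->].
  case=> u1 [u2 [-> /(language_role (Short r)) + /denotes_blockE->]].
  case=> [N [N' [m [s [[N_gt0 Er] nN lt_mN' sa ->]]]]]; rewrite -Er in Et.
  exists (modulus M + N), (N' + e), (m + j), s; rewrite residue_shift // addn_gt0 N_gt0 orbT.
  split=> //; last by rewrite nseqD -!catA /= nseqD.
    by rewrite (next_shift N_gt0 Et) addnC; move: nN; rewrite /next Et => -[->].
  by rewrite -addSn leq_add.
- move=> r e d j Hr Et Hj /denotes_block[u0 ->].
  case=> u1 [u2 [-> /(language_role Sep) [s sa ->] /denotes_blockE->]].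
  by exists r, d, j, s; rewrite residue_small // (next_small Hr Et); case/andP: Hr.
- move=> r Hr /denotes_block[u0 -> /(denotes_var (X := Block r))[N [N_gt0 Er] ->]].
  by exists (modulus M + N); rewrite ?residue_shift ?nseqD // addn_gt0 N_gt0 orbT.
- move=> r Hr /denotes_blockE->; exists r; rewrite ?residue_small //.
  by case/andP: Hr.
Qed.

Lemma run_grammar_sound X w : generates G (role_code X) w -> meaning X w.
Proof.
move=> Gw; apply/language_role; apply: denotes_derivation Gw => p Gp u Hu.
have [Y -> HY] := run_grammar_inv n_gt0 Gp.
by apply/language_role; apply: run_rule_sound HY Hu.
Qed.

(** Let [H] be the accepting history. A derivation of [s :: H] that begins with
[Start => s Cut Any] would make [Cut] generate a prefix of [H]. *)
Lemma not_total_run s : s != a -> run M n true -> ~ total_grammar G.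
Proof.
move=> sa /(run_history sa)[H HH] /(_ (s :: H) isT)/(run_grammar_sound (X := Start)).
by move/(_ s H HH).
Qed.

Lemma der_rule X rhs w : run_rule a M n X rhs -> der G rhs w -> der G [:: var A X] w.
Proof. by move/(run_rule_mem n_gt0); apply: der_production. Qed.

Lemma der_var X rhs w1 w2 : der G [:: var A X] w1 -> der G rhs w2 ->
  der G (var A X :: rhs) (w1 ++ w2).
Proof. exact: der_cat. Qed.

Lemma der_nil : der G [::] [::].
Proof. exact: (der_terminals _ [::]). Qed.

Lemma der_block k : der G (block a k) (nseq k a).
Proof. exact: der_terminals. Qed.

Lemma nil_suffix : [::] \in suffixes A.
Proof. by rewrite mem_suffixes. Qed.

Lemma any_suffix : [:: var A Any] \in suffixes A.
Proof. by rewrite mem_suffixes eqxx orbT. Qed.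

Lemma der_suffix w : exists2 l, l \in suffixes A & der G l w.
Proof.
have [->|w0] := eqVneq w [::]; first by exists [::]; [apply: nil_suffix | apply: der_nil].
exists [:: var A Any]; first exact: any_suffix.
elim: w w0 => // c w IHw _; have [->|/IHw Hw] := eqVneq w [::].
  exact: der_rule (any_rule _ _ _ c nil_suffix) (der_letter _ der_nil).
exact: der_rule (any_rule _ _ _ c any_suffix) (der_letter _ Hw).
Qed.

Lemma der_any w : w != [::] -> der G [:: var A Any] w.
Proof.
case: w => // c w _; have [l Hl Hw] := der_suffix w.
exact: der_rule (any_rule _ _ _ _ Hl) (der_letter _ Hw).
Qed.

Lemma der_sep s : s != a -> der G [:: var A Sep] [:: s].
Proof. by move=> sa; apply: der_rule (sep_rule _ _ sa) (der_letter _ der_nil). Qed.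

Lemma der_prefix x : boundary a x -> exists2 l, l \in prefixes A & der G l x.
Proof.
case/lastP: x => [|x s]; first by exists [::]; [rewrite mem_prefixes | apply: der_nil].
rewrite /boundary last_rcons -size_eq0 size_rcons /= -cats1 => sa.
have [->|x0] := eqVneq x [::].
  by exists [:: var A Sep]; [rewrite mem_prefixes eqxx orbT | apply: der_sep].
exists [:: var A Any; var A Sep]; first by rewrite mem_prefixes eqxx !orbT.
exact: der_var (der_any x0) (der_sep sa).
Qed.

Lemma der_Block N : 0 < N -> der G [:: var A (Block (residue M N))] (nseq N a).
Proof.
elim/(@residue_ind M)=> {N} [r Hr|N N_gt0 IHN].
  by rewrite residue_small //; apply: der_rule (block_base _ _ Hr) (der_block _).
rewrite residue_shift // nseqD; apply: der_rule (block_step _ _ (residue_bounds _ _)) _.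
exact: der_cat (der_block _) IHN.
Qed.

Lemma der_Long N N' s : 0 < N -> next M N = Some N' -> s != a ->
  der G [:: var A (Long (residue M N))] (nseq N a ++ s :: nseq N' a).
Proof.
move=> N_gt0 + sa; move: N N_gt0 N'; apply: (@residue_ind M) => [r Hr|N N_gt0 IHN] N'.
  rewrite /next residue_small //; case Et: (table M r) => [[e d]|] // [<-].
  have -> : quotient M r * e + d = d by have := @quotientMD M 0 r Hr; rewrite /= mul0n add0n => ->.
  apply: der_rule (long_base _ _ Hr Et) _; apply: der_cat (der_block _) _.
  exact: der_var (der_sep sa) (der_block d).
have Hr := residue_bounds M N.
case Et: (table M (residue M N)) => [[e d]|]; last by rewrite /next residue_shift // Et.
rewrite residue_shift // (next_shift N_gt0 Et) addnC => -[<-].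
have := IHN _ (next_eq (erefl _) Et) => {}IHN.
rewrite nseqD -catA nseqD -cat_cons catA.
apply: der_rule (long_step _ _ Hr Et) _; rewrite -catA; apply: der_cat (der_block _) _.
by rewrite catA; apply: der_var IHN (der_block e).
Qed.

Lemma der_Short N N' m s : 0 < N -> next M N = Some N' -> m < N' -> s != a ->
  der G [:: var A (Short (residue M N))] (nseq N a ++ s :: nseq m a).
Proof.
move=> N_gt0 + + sa; move: N N_gt0 N' m; apply: (@residue_ind M) => [r Hr|N N_gt0 IHN] N' m.
  rewrite /next residue_small //; case Et: (table M r) => [[e d]|] // [<-].
  have -> : quotient M r * e + d = d by have := @quotientMD M 0 r Hr; rewrite /= mul0n add0n => ->.
  move=> lt_md; apply: der_rule (short_base _ _ Hr Et lt_md) _; apply: der_cat (der_block _) _.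
  exact: der_var (der_sep sa) (der_block m).
have Hr := residue_bounds M N.
case Et: (table M (residue M N)) => [[e d]|]; last by rewrite /next residue_shift // Et.
rewrite residue_shift // (next_shift N_gt0 Et) addnC => -[<-] lt_m.
have nN := next_eq (erefl _) Et; have N'_gt0 := next_gt0 nN.
(* The missing letters may be missing at any level of the recursion: take as many
   letters as possible, at most [e], in the outermost step. *)
pose j := minn m e.
have lt_mj : m - j < quotient M N * e + d by rewrite /j; lia.
have le_je : j <= e by apply: geq_minr.
have -> : m = (m - j) + j by rewrite subnK // geq_minl.
rewrite nseqD -catA nseqD -cat_cons catA.
apply: der_rule (short_step _ _ Hr Et le_je) _; rewrite -catA; apply: der_cat (der_block _) _.
by rewrite catA; apply: der_var (IHN _ _ nN lt_mj) (der_block j).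
Qed.

(** [Cut] needs a letter after the word of [Head], so that its production contains a
terminal; only short words are left to [Head] itself. *)
Lemma der_mismatch u : mismatch a n u ->
  der G [:: var A Cut] u \/ der G [:: var A Head] u /\ size u <= n.+1.
Proof.
suff: mismatch a n u -> exists u1 u2,
    [/\ u = u1 ++ u2, der G [:: var A Head] u1 & size u1 <= n.+1].
  move=> + mis => /(_ mis)[u1 [u2 [-> du1 le_u1n]]].
  case: u2 => [|c u2]; first by right; rewrite cats0.
  left; have [l Hl du2] := der_suffix u2.
  exact: der_rule (cut_head _ _ _ _ Hl) (der_var du1 (der_letter _ du2)).
move=> [[i [s [y [lt_in sa ->]]]]|[y ->]]; last first.
  exists (nseq n.+1 a), y; split; rewrite ?size_nseq //.
  exact: der_rule (head_long _ _ _) (der_block _).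
exists (nseq i a ++ [:: s]), y; rewrite -catA size_cat size_nseq addn1 ltnS ltnW //; split=> //.
case: i lt_in => [|i] lt_in; first exact: der_rule (head_sep _ _ sa) (der_letter _ der_nil).
by apply: der_rule (head_short _ _ _) (der_cat (der_block i.+1) (der_sep sa)).
Qed.

Lemma der_cut_next x N N' s y : boundary a x -> 0 < N -> next M N = Some N' -> s != a ->
  mismatch a N' y -> der G [:: var A Cut] (x ++ nseq N a ++ s :: y).
Proof.
move=> /der_prefix[l' Hl' dx] N_gt0 nN sa.
have Hr := residue_bounds M N.
case Et: (table M (residue M N)) => [t|]; last by move: nN; rewrite /next Et.
case=> [[m [s' [z [lt_m s'a ->]]]]|[z ->]]; have [l Hl dz] := der_suffix z.
  have -> : x ++ nseq N a ++ s :: nseq m a ++ s' :: z =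
      (x ++ (nseq N a ++ s :: nseq m a) ++ [:: s']) ++ z by rewrite -!catA /= -?catA.
  apply: der_rule (cut_short _ Hl' Hr Et s'a Hl) _; apply: der_cat dz; apply: der_cat dx _.
  exact: der_var (der_Short N_gt0 nN lt_m sa) (der_letter _ der_nil).
have -> : x ++ nseq N a ++ s :: nseq N'.+1 a ++ z =
    (x ++ (nseq N a ++ s :: nseq N' a) ++ [:: a]) ++ z.
  by rewrite -addn1 nseqD -!catA /= -?catA.
apply: der_rule (cut_long _ _ Hl' Hr Et Hl) _; apply: der_cat dz; apply: der_cat dx _.
exact: der_var (der_Long N_gt0 nN sa) (der_letter _ der_nil).
Qed.

Lemma der_cut_halt x N s y : boundary a x -> 0 < N -> next M N = None -> s != a ->
  y != [::] -> der G [:: var A Cut] (x ++ nseq N a ++ s :: y).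
Proof.
move=> /der_prefix[l' Hl' dx] N_gt0 nN sa y0.
have Et : table M (residue M N) = None by move: nN; rewrite /next; case: (table _ _) => [[]|].
apply: der_rule (cut_halt _ Hl' (residue_bounds M N) Et sa) _; apply: der_cat dx _.
exact: der_var (der_Block N_gt0) (der_letter _ (der_any y0)).
Qed.

(** By induction on the run: a word that is longer than the written run either has
an error or goes on after a final block. The bound does not depend on [x], the
part of the history that was already checked. *)
Lemma der_cut_run N b : run M N b -> 0 < N -> exists k, forall x u,
  boundary a x -> k <= size u -> mismatch a N u \/ der G [:: var A Cut] (x ++ u).
Proof.
elim=> {N b} [N nN|N N' b nN _ IH] N_gt0.
  exists N.+2 => x u bx le_ku.
  case: (block_cases a N u) => [[s [y [sa Eu]]]||[i le_iN Eu]]; [|by left|].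
    right; rewrite Eu; apply: der_cut_halt => //; apply: contraTneq le_ku => y0.
    by rewrite Eu y0 size_cat size_nseq addn1 ltnn.
  by move: le_ku; rewrite Eu size_nseq; lia.
have [k Hk] := IH (next_gt0 nN); exists (N.+1 + k) => x u bx le_ku.
case: (block_cases a N u) => [[s [y [sa Eu]]]||[i le_iN Eu]]; [|by left|].
  right; have le_ky : k <= size y by move: le_ku; rewrite Eu size_cat size_nseq /=; lia.
  have [|dy] := Hk (x ++ nseq N a ++ [:: s]) y (boundary_block _ bx sa) le_ky.
    by rewrite Eu; apply: der_cut_next.
  by rewrite Eu; move: dy; rewrite -!catA.
by move: le_ku; rewrite Eu size_nseq; lia.
Qed.

(** By induction on the run: if the run from [N] ends without accepting, then every
word fails to be an accepting history of [N] in one of the ways that the grammar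
detects. *)
Lemma der_start_run N : run M N false -> 0 < N -> forall x u, boundary a x -> u != [::] ->
  [\/ mismatch a N u, der G [:: var A Cut] (x ++ u)
    | forall c, der G [:: var A Start] (c :: x ++ u)].
Proof.
have open x i : 0 < i -> forall c, der G [:: var A Start] (c :: x ++ nseq i a).
  case: i => // i _ c; have -> : x ++ nseq i.+1 a = (x ++ nseq i a) ++ [:: a].
    by rewrite -catA -addn1 nseqD.
  have da : der G [:: letter a] [:: a] by apply/der_letter/der_nil.
  have [->|w0] := eqVneq (x ++ nseq i a) [::].
    exact: der_rule (start_open _ _ _ _) (der_letter _ da).
  apply: der_rule (start_any_open _ _ _ _) (der_letter _ _).
  exact: der_var (der_any w0) da.
have refuse x K s : boundary a x -> 0 < K -> s != a ->
    ~~ ((next M K == None) && accepting M (residue M K)) ->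
    forall c, der G [:: var A Start] (c :: x ++ nseq K a ++ [:: s]).
  move=> /der_prefix[l Hl dx] K_gt0 sa acc c.
  have Hacc : ~~ ((table M (residue M K) == None) && accepting M (residue M K)).
    by move: acc; rewrite /next; case: (table _ _) => [[]|].
  apply: der_rule (start_refuse _ _ _ Hl (residue_bounds M K) Hacc) _.
  apply/der_letter/(der_cat dx); exact: der_var (der_Block K_gt0) (der_sep sa).
move Eb: false => b HN.
elim: HN Eb => {N b} [N nN|N N' b nN _ IH] Eb N_gt0 x u bx u0;
  case: (block_cases a N u) => [[s [y [sa Eu]]]|?|[i le_iN Eu]]; rewrite ?Eu.
- have [->|y0] := eqVneq y [::]; last by apply: Or32; apply: der_cut_halt.
  by apply: Or33; apply: refuse; rewrite // -Eb andbF.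
- exact: Or31.
- by apply: Or33; apply: open; move: u0; rewrite Eu; case: i {le_iN Eu}.
- have [->|y0] := eqVneq y [::]; first by apply: Or33; apply: refuse; rewrite ?nN.
  have [|dy|dy] := IH Eb (next_gt0 nN) (x ++ nseq N a ++ [:: s]) y (boundary_block _ bx sa) y0.
  + by move=> mis; apply: Or32; apply: der_cut_next mis.
  + by apply: Or32; move: dy; rewrite -!catA.
  by apply: Or33 => c; move: (dy c); rewrite -!catA.
- exact: Or31.
- by apply: Or33; apply: open; move: u0; rewrite Eu; case: i {le_iN Eu}.
Qed.

(** The number required by regular totality is any length from which on [Cut]
generates all words. *)
Lemma regularly_total_run : run M n false -> regularly_total G.
Proof.
move=> Hn; exists (role_code Cut), (role_code Any); split=> // [c|].
  split; first exact: (run_rule_mem n_gt0 (start_cut_any a M n c)).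
    exact: (run_rule_mem n_gt0 (any_rule a M n c nil_suffix)).
  exact: (run_rule_mem n_gt0 (any_rule a M n c any_suffix)).
have b0 : boundary a [::] by [].
have [k Hk] := der_cut_run Hn n_gt0.
exists (maxn k n.+2); split; first by rewrite leq_max orbT.
  case=> // c u _ _; have [->|u0] := eqVneq u [::].
    exact: der_rule (start_letter _ _ _ c) (der_letter _ der_nil).
  have cut : der G [:: var A Cut] u -> generates G start (c :: u).
    by move=> du; apply: der_rule (start_cut _ _ _ c) (der_letter _ du).
  have [/der_mismatch[|[du _]]||du] := der_start_run Hn n_gt0 b0 u0.
  - exact: cut.
  - exact: der_rule (start_head _ _ _ c) (der_letter _ du).
  - exact: cut.
  - exact: du.
move=> u Eu; have [||//] := Hk [::] u b0; first by rewrite Eu leq_maxl.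
by case/der_mismatch=> // -[_]; rewrite Eu leqNgt leq_max leqnn orbT.
Qed.

Lemma productive_run_grammar : productive G.
Proof.
pose is_letter (t : symbol A) := if t is inl _ then true else false.
have block_letter k rhs : 0 < k -> has is_letter (block a k ++ rhs) by case: k.
have block_letter0 k : 0 < k -> has is_letter (block a k) by case: k.
apply/allP=> p Gp; have [X _] := run_grammar_inv n_gt0 Gp.
move: p.2 => {p Gp} rhs; rewrite -/(is_letter _); case=> {X rhs} //=.
- by move=> k /andP[k_gt0 _]; apply: block_letter.
- by move=> r t l' l _ _ _ _; rewrite !has_cat /= orbT.
- by move=> r t s l' l _ _ _ _ _; rewrite !has_cat /= orbT.
- by move=> r s l' _ _ _ _; rewrite !has_cat /= orbT.
- by move=> *; apply/block_letter/modulus_gt0.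
- by move=> r e d /andP[r_gt0 _] *; apply: block_letter.
- by move=> *; apply/block_letter/modulus_gt0.
- by move=> r e d j /andP[r_gt0 _] *; apply: block_letter.
- by move=> *; apply/block_letter/modulus_gt0.
- by move=> r /andP[r_gt0 _]; apply: block_letter0.
Qed.

End Languages.

(** * Structured register programs *)

Definition state := nat -> nat.
Definition upd (s : state) r x : state := fun r' => if r' == r then x else s r'.

(** [Loop r c] is: while register [r] is positive, decrement it and execute [c]. *)
Inductive cmd := Skip | Inc of nat | Seq of cmd & cmd | Loop of nat & cmd.

(** Terminating executions only; divergence never has to be simulated. *)
Inductive exec : cmd -> state -> state -> Prop :=
| exec_skip s : exec Skip s s
| exec_inc r s : exec (Inc r) s (upd s r (s r).+1)
| exec_seq c1 c2 s1 s2 s3 : exec c1 s1 s2 -> exec c2 s2 s3 -> exec (Seq c1 c2) s1 s3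
| exec_exit r c s : s r = 0 -> exec (Loop r c) s s
| exec_loop r c s1 s2 s3 x : s1 r = x.+1 -> exec c (upd s1 r x) s2 ->
    exec (Loop r c) s2 s3 -> exec (Loop r c) s1 s3.

Ltac upd_eq :=
  apply/funext => ?; rewrite /upd; repeat (case: eqP => ?); subst; try lia; try congruence.

Lemma exec_eq c s1 s2 s3 : exec c s1 s2 -> s2 = s3 -> exec c s1 s3.
Proof. by move=> ? <-. Qed.

(** [I k] is the state at the loop test when [k] iterations remain. *)
Lemma exec_iterate r c (I : nat -> state) n : I 0 r = 0 ->
  (forall k, k < n -> exists2 x, I k.+1 r = x.+1 & exec c (upd (I k.+1) r x) (I k)) ->
  exec (Loop r c) (I n) (I 0).
Proof.
move=> I0; elim: n => [|n IHn] HI; first exact: exec_exit.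
have [x Ix cx] := HI n (leqnn _); apply: exec_loop Ix cx _.
by apply: IHn => k lt_kn; apply/HI/ltnW.
Qed.

Definition clear r := Loop r Skip.

Lemma exec_clear r s : exec (clear r) s (upd s r 0).
Proof.
pose I k := upd s r k; apply: (exec_eq (s2 := I 0)) => //.
have -> : s = I (s r) by rewrite /I; upd_eq.
apply: exec_iterate; first by rewrite /I /upd eqxx.
move=> k _; exists k; first by rewrite /I /upd eqxx.
by apply: exec_eq (exec_skip _) _; rewrite /I; upd_eq.
Qed.

Definition move r out := Loop r (Inc out).

Lemma exec_move r out s : r != out ->
  exec (move r out) s (upd (upd s out (s out + s r)) r 0).
Proof.
move=> /eqP ne; pose I k := upd (upd s out (s out + (s r - k))) r k.
apply: (exec_eq (s2 := I 0)); last by rewrite /I; upd_eq.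
have {1}-> : s = I (s r) by rewrite /I; upd_eq.
apply: exec_iterate; first by rewrite /I /upd eqxx.
move=> k lt_k; exists k; first by rewrite /I /upd eqxx.
by apply: exec_eq (exec_inc _ _) _; rewrite /I; upd_eq.
Qed.

Definition copy r out tmp := Seq (Loop r (Seq (Inc tmp) (Inc out))) (move tmp r).

Lemma exec_copy r out tmp s : r != out -> r != tmp -> tmp != out -> s tmp = 0 ->
  exec (copy r out tmp) s (upd s out (s out + s r)).
Proof.
move=> /eqP ne1 /eqP ne2 /eqP ne3 s0.
pose I k := upd (upd (upd s out (s out + (s r - k))) tmp (s r - k)) r k.
apply: (exec_seq (s2 := I 0)).
  have {1}-> : s = I (s r) by rewrite /I; upd_eq.
  apply: exec_iterate; first by rewrite /I /upd eqxx.
  move=> k lt_k; exists k; first by rewrite /I /upd eqxx.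
  apply: exec_seq (exec_inc _ _) _.
  by apply: exec_eq (exec_inc _ _) _; rewrite /I; upd_eq.
apply: exec_eq (exec_move _ _) _; first by rewrite eq_sym; apply/eqP.
by rewrite /I; upd_eq.
Qed.

(** [c] adds the value of [p] to register [out] and leaves all other registers as they
were; registers from [fr] on are free for scratch work and are returned empty. With
this convention programs compose without any saving of registers. *)
Definition implements n (p : murec n) (inp : 'I_n -> nat) out fr c : Prop :=
  forall s (v : n.-tuple nat) y, (forall r, fr <= r -> s r = 0) ->
    (forall i, s (inp i) = tnth v i) -> murec_graph p v y ->
    exec c s (upd s out (s out + y)).

Definition compilable n (p : murec n) : Prop :=
  forall inp out fr, (forall i, inp i < fr) -> out < fr -> (forall i, inp i != out) ->
    exists c, implements p inp out fr c.

Lemma compilable_zero n : compilable (MZero n).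
Proof.
move=> inp out fr _ _ _; exists Skip => s v y _ _ ->.
by apply: exec_eq (exec_skip _) _; upd_eq.
Qed.

Lemma compilable_proj n i : compilable (@MProj n i).
Proof.
move=> inp out fr Hinp Hout ne; exists (copy (inp i) out fr) => s v y s0 Hv ->.
rewrite -Hv; apply: exec_copy => //; last exact: s0.
  by rewrite ltn_eqF.
by rewrite gtn_eqF.
Qed.

Lemma compilable_succ : compilable MSucc.
Proof.
move=> inp out fr Hinp Hout ne; exists (Seq (copy (inp ord0) out fr) (Inc out)).
move=> s v y s0 Hv ->.
apply: exec_seq.
  apply: exec_copy; [exact: ne| | |exact: s0].
    by rewrite ltn_eqF.
  by rewrite gtn_eqF.
apply: exec_eq (exec_inc _ _) _; rewrite Hv; have -> : thead v = tnth v ord0 by [].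
by upd_eq.
Qed.

Lemma compilable_comp n m (g : murec m) (h : 'I_m -> murec n) :
  compilable g -> (forall i, compilable (h i)) -> compilable (MComp g h).
Proof.
move=> Hg Hh inp out fr Hinp Hout ne.
have /choice[ch Hch] : forall i : 'I_m, exists c, implements (h i) inp (fr + i) (fr + m) c.
  move=> i; apply: Hh => [j||j].
  - exact: leq_trans (Hinp j) (leq_addr _ _).
  - by rewrite ltn_add2l.
  - by rewrite ltn_eqF // (leq_trans (Hinp j)) // leq_addr.
have [|||cg Hcg] := Hg (fun i => fr + i) out (fr + m).
- by move=> i; rewrite ltn_add2l.
- exact: leq_trans Hout (leq_addr _ _).
- by move=> i; rewrite gtn_eqF // (leq_trans Hout) // leq_addr.
pose c i := if insub i is Some i' then ch i' else Skip.
pose args j := iteri j (fun i d => Seq d (c i)) Skip.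
pose clears j := iteri j (fun i d => Seq d (clear (fr + i))) Skip.
exists (Seq (args m) (Seq cg (clears m))) => s v y s0 Hv [w [Hw Hy]].
(* The arguments computed so far; scratch registers are empty elsewhere. *)
pose S j : state := fun r => if fr <= r < fr + j then nth 0 w (r - fr) else s r.
have exec_args j : j <= m -> exec (args j) s (S j).
  elim: j => [|j IHj] le_jm.
    apply: exec_eq (exec_skip _) _; apply/funext => r; rewrite /S.
    by case: ifP => //; lia.
  apply: exec_seq (IHj (ltnW le_jm)) _; rewrite /c insubT.
  set i := Sub j le_jm.
  apply: exec_eq (Hch i (S j) v (tnth w i) _ _ (Hw i)) _.
  - by move=> r le_r; rewrite /S s0 ?if_same; [case: ifP => //; lia | lia].
  - by move=> i'; rewrite /S -Hv; have := Hinp i'; case: ifP => //; lia.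
  rewrite (tnth_nth 0); apply/funext => r; rewrite /upd /S /=.
  case: eqP => [->|]; last by case: ifP; case: ifP => //; lia.
  by rewrite (s0 (fr + j)) ?leq_addr //; do 2 case: ifP; rewrite ?add0n ?addKn //; lia.
pose S' j : state := fun r => if fr <= r < fr + j then 0 else upd (S m) out (s out + y) r.
have exec_clears j : exec (clears j) (upd (S m) out (s out + y)) (S' j).
  elim: j => [|j IHj].
    apply: exec_eq (exec_skip _) _; apply/funext => r; rewrite /S'.
    by case: ifP => //; lia.
  apply: exec_seq IHj _; apply: exec_eq (exec_clear _ _) _.
  apply/funext => r; rewrite /upd /S'; case: eqP => [->|]; first by case: ifP => //; lia.
  by case: ifP; case: ifP => //; lia.
apply: exec_seq (exec_args m (leqnn m)) _; apply: exec_seq.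
  apply: (Hcg (S m) w y) => // [r le_r|i].
  - by rewrite /S s0; [case: ifP => //; lia | lia].
  - by rewrite /S (tnth_nth 0) addKn; have := ltn_ord i; case: ifP => //; lia.
have -> : S m out = s out by rewrite /S; case: ifP => //; lia.
apply: exec_eq (exec_clears m) _; apply/funext => r; rewrite /S' /upd /S.
case: ifP => [/andP[le_r lt_r]|->] //.
by case: eqP => [Er|_]; [lia | rewrite s0].
Qed.

(** The chain of intermediate values of a primitive recursion. *)
Lemma murec_graph_recP n (g : murec n) (h : murec n.+2) (v : n.+1.-tuple nat) y :
  let t := [tuple of behead v] in murec_graph (MRec g h) v y ->
  exists z : nat -> nat, [/\ murec_graph g t (z 0),
    forall k, k < thead v -> murec_graph h [tuple of k :: z k :: t] (z k.+1)
    & z (thead v) = y].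
Proof.
move=> t /=; elim: (thead v) y => [|k IHk] y; first by move=> gy; exists (fun _ => y).
case=> x [/IHk[z [z0 zS zk]] hy]; pose z' i := if i <= k then z i else y.
exists z'; rewrite /z' ltnn; split=> // i lt_i.
have [->|lt_ik] : i = k \/ i < k by lia.
  by rewrite leqnn ltnn zk.
by rewrite (ltnW lt_ik) lt_ik; apply: zS.
Qed.

Lemma compilable_rec n (g : murec n) (h : murec n.+2) :
  compilable g -> compilable h -> compilable (MRec g h).
Proof.
move=> Hg Hh inp out fr Hinp Hout ne.
(* Remaining iterations, index, current value and next value. *)
have [K [J [Z [Z' [fr' [EK EJ EZ EZ' Efr]]]]]] : exists K J Z Z' fr',
    [/\ K = fr, J = fr.+1, Z = fr.+2, Z' = fr.+3 & fr' = fr.+4] by do 5!eexists.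
pose tinp (i : 'I_n) := inp (lift ord0 i).
have Htinp i : tinp i < fr by apply: Hinp.
have [i||i|cg Hcg] := Hg tinp Z fr'; try by [lia | have := Htinp i; lia].
pose hinp (i : 'I_n.+2) := if unlift ord0 i is Some j then
    if unlift ord0 j is Some k then tinp k else Z else J.
have hinp0 : hinp ord0 = J by rewrite /hinp unlift_none.
have hinp1 : hinp (lift ord0 ord0) = Z by rewrite /hinp liftK unlift_none.
have hinp2 i : hinp (lift ord0 (lift ord0 i)) = tinp i by rewrite /hinp !liftK.
have hinpP (P : nat -> Prop) : P J -> P Z -> (forall i, P (tinp i)) -> forall i, P (hinp i).
  move=> PJ PZ Pt i; case: (unliftP ord0 i) => [j|] ->; rewrite ?hinp0 //.
  by case: (unliftP ord0 j) => [k|] ->; rewrite ?hinp1 ?hinp2.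
have [|||ch Hch] := Hh hinp Z' fr'; try lia.
- by apply: (hinpP (fun r => r < fr')) => [||i]; try have := Htinp i; lia.
- by apply: (hinpP (fun r => r != Z')) => [||i]; try have := Htinp i; lia.
pose body := Seq ch (Seq (clear Z) (Seq (move Z' Z) (Inc J))).
exists (Seq (copy (inp ord0) K Z) (Seq cg (Seq (Loop K body) (Seq (move Z out) (clear J))))).
move=> s v y s0 Hv /murec_graph_recP[z [Hz0 HzS Ey]].
set t := [tuple of behead v] in Hz0 HzS; set m := thead v in HzS Ey.
have inpE : s (inp ord0) = m by rewrite Hv.
have Hinp0 := Hinp ord0; have ne0 : inp ord0 <> out by apply/eqP.
have tinpE i : s (tinp i) = tnth t i.
  by rewrite Hv /t tnth_behead; congr tnth; apply: val_inj; rewrite /= inordK // ltnS.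
pose I k : state := upd (upd (upd s K k) J (m - k)) Z (z (m - k)).
have [sK sJ sZ sZ'] : [/\ s K = 0, s J = 0, s Z = 0 & s Z' = 0].
  by split; apply: s0; lia.
apply: exec_seq; first by apply: exec_copy; lia.
apply: exec_seq.
  apply: (Hcg _ t (z 0)) => // [r le_r|i]; rewrite /upd; case: eqP => [|_] //.
  - lia.
  - by rewrite s0 //; lia.
  - by have := Htinp i; lia.
apply: (exec_seq (s2 := I 0)).
  have -> : upd (upd s K (s K + s (inp ord0))) Z (upd s K (s K + s (inp ord0)) Z + z 0) = I m.
    by rewrite sK inpE /I subnn; upd_eq.
  apply: exec_iterate; first by rewrite /I /upd; repeat (case: eqP => ?); lia.
  move=> k lt_km; exists k; first by rewrite /I /upd; repeat (case: eqP => ?); lia.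
  set s1 := upd _ K k; pose i := m - k.+1.
  have Ei : m - k = i.+1 by rewrite /i; lia.
  have [s1K s1J s1Z s1Z'] : [/\ s1 K = k, s1 J = i, s1 Z = z i & s1 Z' = 0].
    by rewrite /s1 /I /upd -/i; split; repeat (case: eqP => ?); lia.
  have s1E r : r <> K -> r <> J -> r <> Z -> s1 r = s r.
    by rewrite /s1 /I /upd; repeat (case: eqP => ?).
  apply: exec_seq.
    apply: (Hch s1 [tuple of i :: z i :: t] (z i.+1)); last by apply: HzS; rewrite /i; lia.
      by move=> r le_r; rewrite s1E ?s0 //; lia.
    move=> j; case: (unliftP ord0 j) => [j1|] ->; last by rewrite hinp0.
    rewrite tnthS; case: (unliftP ord0 j1) => [j2|] ->; last by rewrite hinp1.
    by rewrite hinp2 tnthS -tinpE s1E; have := Htinp j2; lia.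
  apply: exec_seq (exec_clear _ _) _; apply: exec_seq; first by apply: exec_move; lia.
  apply: exec_eq (exec_inc _ _) _; rewrite /I Ei.
  clearbody s1 i; apply/funext=> r; rewrite /upd.
  repeat (case: eqP => ?); try (subst; lia).
  by apply: s1E; lia.
apply: exec_seq; first by apply: exec_move; lia.
apply: exec_eq (exec_clear _ _) _; rewrite /I subn0 Ey; upd_eq.
Qed.

Lemma compilable_min n (g : murec n.+1) : compilable g -> compilable (MMin g).
Proof.
move=> Hg inp out fr Hinp Hout ne.
(* The candidate and the value of [g] at it. *)
have [Y [R [fr' [EY ER Efr]]]] : exists Y R fr', [/\ Y = fr, R = fr.+1 & fr' = fr.+2].
  by do 3!eexists.
pose ginp (i : 'I_n.+1) := if unlift ord0 i is Some j then inp j else Y.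
have ginp0 : ginp ord0 = Y by rewrite /ginp unlift_none.
have ginp1 i : ginp (lift ord0 i) = inp i by rewrite /ginp liftK.
clearbody ginp.
have [|||c Hc] := Hg ginp R fr'; try lia.
- by move=> i; case: (unliftP ord0 i) => [j|] ->; rewrite ?ginp0 ?ginp1; try have := Hinp j; lia.
- by move=> i; case: (unliftP ord0 i) => [j|] ->; rewrite ?ginp0 ?ginp1; try have := Hinp j; lia.
exists (Seq c (Seq (Loop R (Seq (clear R) (Seq (Inc Y) c))) (move Y out))).
move=> s v y s0 Hv [/= Hy0 HyS].
have /choice[w Hw] : forall i, exists x, [/\ i <= y -> murec_graph g [tuple of i :: v] x,
    i < y -> 0 < x & i = y -> x = 0].
  move=> i; case: (ltngtP i y) => [lt_iy|lt_yi|->].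
  - by have [x Hx] := HyS i lt_iy; exists x.+1; split=> //; lia.
  - by exists 0; split=> //; lia.
  - by exists 0.
have [sY sR] : s Y = 0 /\ s R = 0 by split; apply: s0; lia.
pose I k : state := upd (upd s Y (y - k)) R (w (y - k)).
have step i s1 : i <= y -> s1 = upd s Y i -> exec c s1 (upd s1 R (w i)).
  move=> le_iy Es1; have [/(_ le_iy) gi _ _] := Hw i.
  have s1R : s1 R = 0 by rewrite Es1 /upd; case: eqP => //; lia.
  have := Hc s1 [tuple of i :: v] (w i); rewrite s1R; apply=> //.
    by move=> r le_r; rewrite Es1 /upd; case: eqP; [lia | rewrite s0 //; lia].
  move=> j; case: (unliftP ord0 j) => [j1|] ->.
    by rewrite ginp1 tnthS -Hv Es1 /upd; have := Hinp j1; case: eqP => //; lia.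
  by rewrite ginp0 Es1 /upd eqxx.
apply: exec_seq; first by apply: (step 0) => //; upd_eq.
apply: (exec_seq (s2 := I 0)).
  have -> : upd s R (w 0) = I y by rewrite /I subnn; upd_eq.
  apply: exec_iterate.
    by rewrite /I /upd eqxx subn0; have [_ _ ->] := Hw y.
  move=> k lt_ky; exists (w (y - k.+1)).-1.
    rewrite /I /upd eqxx; have [_ + _] := Hw (y - k.+1); case: (w _) => // /(_ _); lia.
  apply: exec_seq (exec_clear _ _) _; apply: exec_seq (exec_inc _ _) _.
  apply: exec_eq (step (y - k) _ _ _) _; [lia| |]; last by rewrite /I; upd_eq.
  by rewrite /I; upd_eq.
apply: exec_eq (exec_move _ _) _; first lia.
by rewrite /I subn0; have [_ _ wy] := Hw y; have {}wy := wy erefl; upd_eq.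
Qed.

Lemma compile n (p : murec n) : compilable p.
Proof.
elim: p => {n}.
- exact: compilable_zero.
- exact: compilable_succ.
- exact: compilable_proj.
- by move=> n m g Hg h Hh; apply: compilable_comp.
- by move=> n g Hg h Hh; apply: compilable_rec.
- by move=> n g Hg; apply: compilable_min.
Qed.

(** * Register machines *)

Inductive instr := IInc of nat | IDec of nat & nat & nat.

Definition instr_register i := match i with IInc r => r | IDec r _ _ => r end.

Definition instr_step i l (s : state) : nat * state :=
  match i with
  | IInc r => (l.+1, upd s r (s r).+1)
  | IDec r l1 l2 => if s r is x.+1 then (l1, upd s r x) else (l2, s)
  end.

(** The code of [c] when it is placed at address [l]; control leaves it at its end.
The test of a loop stands both before and behind the body, so that no separate
jump instruction is needed. *)
Fixpoint assemble c l : seq instr :=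
  match c with
  | Skip => [::]
  | Inc r => [:: IInc r]
  | Seq c1 c2 => assemble c1 l ++ assemble c2 (l + size (assemble c1 l))
  | Loop r c =>
      let b := assemble c l.+1 in
      let test := IDec r l.+1 (l + size b).+2 in
      test :: rcons b test
  end.

Section Reach.
Variable P : seq instr.

Inductive reach : nat -> state -> nat -> state -> Prop :=
| reach_refl l s : reach l s l s
| reach_step l s l1 s1 l2 s2 i : onth P l = Some i -> instr_step i l s = (l1, s1) ->
    reach l1 s1 l2 s2 -> reach l s l2 s2.

Lemma reach_trans l1 s1 l2 s2 l3 s3 : reach l1 s1 l2 s2 -> reach l2 s2 l3 s3 -> reach l1 s1 l3 s3.
Proof.
elim=> // {}l1 {}s1 l s {}l2 {}s2 i Pi step _ IH /IH.
exact: reach_step step.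
Qed.

Lemma reach_one l s l1 s1 i : onth P l = Some i -> instr_step i l s = (l1, s1) -> reach l s l1 s1.
Proof. by move=> Pi step; apply: reach_step Pi step (reach_refl _ _). Qed.

End Reach.

Lemma onth_cat_size T (s1 s2 : seq T) x : onth (s1 ++ x :: s2) (size s1) = Some x.
Proof. by rewrite onth_cat ltnn subnn. Qed.

(** A test behaves in the same way wherever it stands, because its targets are
absolute: this identifies the end of a loop body with the entrance of the loop. *)
Lemma reach_test P r l1 l2 l l' e s s' : onth P l = Some (IDec r l1 l2) ->
  onth P l' = Some (IDec r l1 l2) -> l <> e -> reach P l s e s' -> reach P l' s e s'.
Proof.
move=> Pl Pl' + Hr; case: Hr Pl => {l s e s'} [//|l s l0 s0 e s' i Pl step H0] Pl2 _.
by apply: reach_step Pl' _ H0; move: Pl2; rewrite Pl -step => -[->].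
Qed.

Lemma exec_reach c s s' : exec c s s' -> forall l P1 P2 P, size P1 = l ->
  P = P1 ++ assemble c l ++ P2 -> reach P l s (l + size (assemble c l)) s'.
Proof.
elim=> {c s s'}.
- by move=> s l P1 P2 P El EP; rewrite addn0; apply: reach_refl.
- move=> r s l P1 P2 P <- EP; rewrite addn1; apply: reach_one.
    by rewrite EP; apply: onth_cat_size.
  by [].
- move=> c1 c2 s1 s2 s3 _ IH1 _ IH2 l P1 P2 P El /=; rewrite -catA => EP.
  have /reach_trans := IH1 l P1 _ P El EP; apply.
  rewrite size_cat addnA; apply: (IH2 _ (P1 ++ assemble c1 l) P2); first by rewrite size_cat El.
  by rewrite EP -!catA.
- move=> r c s sr l P1 P2 P <- EP; rewrite /= size_rcons !addnS; apply: reach_one.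
    by rewrite EP; apply: onth_cat_size.
  by rewrite /= sr.
move=> r c s1 s2 s3 x s1r _ IHc _ IHl l P1 P2 P El EP.
set b := assemble c l.+1; set test := IDec r l.+1 (l + size b).+2.
have EP1 : P = P1 ++ test :: b ++ test :: P2 by rewrite EP /= cat_rcons.
have Pl : onth P l = Some test by rewrite EP1 -El; apply: onth_cat_size.
apply: (reach_step Pl); first by rewrite /= s1r; reflexivity.
have /reach_trans : reach P l.+1 (upd s1 r x) (l.+1 + size b) s2.
  by apply: (IHc _ (rcons P1 test) (test :: P2)); rewrite ?size_rcons ?El // EP1 cat_rcons.
apply; apply: (reach_test Pl); last exact: IHl EP.
  rewrite EP1 -cat_rcons catA; have -> : l.+1 + size b = size (rcons P1 test ++ b).
    by rewrite size_cat size_rcons El.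
  exact: onth_cat_size.
by rewrite /= size_rcons; lia.
Qed.

(** * Coding machine states by numbers *)

(** Any injective sequence of primes serves for the coding below. *)
Fixpoint prime_at n : nat := if n is n'.+1 then s2val (prime_above (prime_at n')) else 2.

Lemma prime_prime_at n : prime (prime_at n).
Proof. by case: n => //= n; case: (prime_above _). Qed.

Lemma prime_at_inj : injective prime_at.
Proof.
have lt_prime_at n : prime_at n < prime_at n.+1 by move=> /=; case: (prime_above _).
by apply: incn_inj; apply: leq_mono; apply: homo_ltn => //; apply: ltn_trans.
Qed.

Lemma dvdn_prime_at i j : (prime_at i %| prime_at j) = (i == j).
Proof. by rewrite dvdn_prime2 ?prime_prime_at // (inj_eq prime_at_inj). Qed.

(** Conway's coding: the address and the registers are exponents in one number.
The primes with even index stand for addresses, those with odd index for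
registers. An instruction multiplies the number by a fraction that depends only on
its divisibility by some of the primes, hence only on its residue modulo their
product. *)
Section Code.
Variables (P : seq instr) (K : nat).
Hypothesis PK : forall l i, onth P l = Some i -> instr_register i < K.
Implicit Types s : state.

Definition registers s : nat := \prod_(r < K) prime_at r.*2.+1 ^ s r.
Definition state_code l s : nat := prime_at l.*2 * registers s.

Lemma registers_inc s r : r < K -> registers (upd s r (s r).+1) = prime_at r.*2.+1 * registers s.
Proof.
move=> lt_rK; rewrite /registers [in LHS](bigD1 (Ordinal lt_rK)) //=.
rewrite [in RHS](bigD1 (Ordinal lt_rK)) //=.
rewrite {1}/upd eqxx expnS mulnA; congr (_ * _); apply: eq_bigr => i ne.
by rewrite /upd ifN.
Qed.

Lemma registers_dec s r x : r < K -> s r = x.+1 ->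
  registers s = prime_at r.*2.+1 * registers (upd s r x).
Proof.
move=> lt_rK sr; rewrite -registers_inc //; congr registers; apply/funext=> r'.
by rewrite /upd eqxx; case: eqP => [->|].
Qed.

Lemma registers_gt0 s : 0 < registers s.
Proof. by apply: prodn_gt0 => r; rewrite expn_gt0 prime_gt0 ?prime_prime_at. Qed.

Lemma dvdn_registers i s :
  (prime_at i %| registers s) = [exists r : 'I_K, (i == r.*2.+1) && (0 < s r)].
Proof.
rewrite /registers Euclid_dvd_prod ?prime_prime_at // big_has.
apply/hasP/existsP => [[r _]|[r]].
  by rewrite Euclid_dvdX ?prime_prime_at // dvdn_prime_at; exists r.
by move=> Hr; exists r => //; rewrite Euclid_dvdX ?prime_prime_at // dvdn_prime_at.
Qed.

Lemma dvdn_label l l' s : (prime_at l'.*2 %| state_code l s) = (l' == l).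
Proof.
rewrite Euclid_dvdM ?prime_prime_at // dvdn_prime_at dvdn_registers -!muln2 eqn_pmul2r //.
rewrite orb_idr // => /existsP[r /andP[/eqP Er _]].
by have := congr1 odd Er; rewrite /= !muln2 !odd_double.
Qed.

Lemma dvdn_register r l s : r < K -> (prime_at r.*2.+1 %| state_code l s) = (0 < s r).
Proof.
move=> lt_rK; rewrite Euclid_dvdM ?prime_prime_at // dvdn_prime_at dvdn_registers.
have -> : (r.*2.+1 == l.*2) = false by apply/eqP => /(congr1 odd) /=; rewrite !odd_double.
apply/existsP/idP => [[r' /andP[]]|sr]; last by exists (Ordinal lt_rK); rewrite eqxx.
by rewrite eqSS -!muln2 eqn_pmul2r // => /eqP ->.
Qed.

Definition current r : nat := find (fun l => prime_at l.*2 %| r) (iota 0 (size P)).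

(** The instruction as a pair of numerator and denominator. *)
Definition fraction r : option (nat * nat) :=
  let l := current r in
  omap (fun i => match i with
    | IInc q => (prime_at l.+1.*2 * prime_at q.*2.+1, prime_at l.*2)
    | IDec q l1 l2 =>
        if prime_at q.*2.+1 %| r
        then (prime_at l1.*2, prime_at l.*2 * prime_at q.*2.+1)
        else (prime_at l2.*2, prime_at l.*2)
    end) (onth P l).

Definition code_modulus : nat := \prod_(i < (maxn (size P) K).+1.*2) prime_at i.

(** With [N = q * m + r] and a denominator that divides [m] and [N], the number
[N / den * num] is [q * (m / den * num) + r / den * num]. The test for positivity
succeeds on codes of states; it makes [code_table_gt0] immediate. *)
Definition code_table r : option (nat * nat) :=
  if fraction r is Some (num, den) then
    if 0 < r %/ den * num then Some (code_modulus %/ den * num, r %/ den * num) else None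
  else None.

Lemma code_modulus_gt0 : 0 < code_modulus.
Proof. by apply: prodn_gt0 => i; rewrite prime_gt0 ?prime_prime_at. Qed.

Lemma code_table_gt0 r e c : code_table r = Some (e, c) -> 0 < c.
Proof.
by rewrite /code_table; case: (fraction r) => [[num den]|] //; case: ifP => // + [_ <-].
Qed.

(** The system accepts when the output register, number 1, is not empty: its prime is
[prime_at 3]. *)
Definition machine_system : collatz :=
  @Collatz code_modulus code_table (fun r => prime_at 3 %| r) code_modulus_gt0 code_table_gt0.

Let M := machine_system.

Lemma dvdn_residue p N : p %| code_modulus -> 0 < N -> (p %| residue M N) = (p %| N).
Proof.
by move=> pM N_gt0; rewrite [in RHS](quotient_residue M N_gt0) dvdn_addr // dvdn_mull.
Qed.

Lemma dvdn_modulus i j : i < j -> j < (maxn (size P) K).+1.*2 ->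
  prime_at i * prime_at j %| code_modulus.
Proof.
move=> lt_ij lt_j; have lt_i := ltn_trans lt_ij lt_j.
rewrite /code_modulus (bigD1 (Ordinal lt_j)) //= (bigD1 (Ordinal lt_i)) /=; last first.
  by rewrite -val_eqE /= ltn_eqF.
by rewrite mulnA mulnC dvdn_mulr.
Qed.

Lemma dvdn_modulus1 i : i < (maxn (size P) K).+1.*2 -> prime_at i %| code_modulus.
Proof. by move=> lt_i; rewrite /code_modulus (bigD1 (Ordinal lt_i)) //= dvdn_mulr. Qed.

Lemma state_code_gt0 l s : 0 < state_code l s.
Proof. by rewrite muln_gt0 registers_gt0 prime_gt0 ?prime_prime_at. Qed.

Lemma label_residue l l' s : l' < size P ->
  (prime_at l'.*2 %| residue M (state_code l s)) = (l' == l).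
Proof.
move=> lt_l'; rewrite dvdn_residue ?state_code_gt0 ?dvdn_label //.
by apply: dvdn_modulus1; rewrite ltn_double ltnS leq_max ltnW.
Qed.

Lemma register_residue l r s : r < K ->
  (prime_at r.*2.+1 %| residue M (state_code l s)) = (0 < s r).
Proof.
move=> lt_r; rewrite dvdn_residue ?state_code_gt0 ?dvdn_register //.
by apply: dvdn_modulus1; rewrite doubleS !ltnS leq_double leq_max (ltnW lt_r) orbT.
Qed.

Lemma onth_size l i : onth P l = Some i -> l < size P.
Proof. by case: (ltnP l (size P)) => // /onth_default ->. Qed.

Lemma current_residue l s : l <= size P -> current (residue M (state_code l s)) = l.
Proof.
move=> le_l; transitivity (index l (iota 0 (size P))).
  apply: eq_in_find => l'; rewrite mem_iota /= add0n => lt_l'.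
  exact: label_residue.
move: le_l; rewrite leq_eqVlt => /predU1P[El|lt_l].
  by rewrite memNindex ?size_iota // mem_iota El add0n ltnn andbF.
have El := nth_iota 0 0 lt_l; rewrite add0n in El.
by rewrite -{1}El index_uniq ?iota_uniq ?size_iota.
Qed.

Lemma next_fraction N num den : 0 < N -> 0 < num -> den %| code_modulus -> den %| N ->
  fraction (residue M N) = Some (num, den) -> next M N = Some (N %/ den * num).
Proof.
move=> N_gt0 num_gt0 dM dN Hfr; rewrite /next /= /code_table Hfr.
have d_gt0 : 0 < den by apply: dvdn_gt0 dN.
have dr : den %| residue M N by rewrite dvdn_residue.
have r_gt0 : 0 < residue M N %/ den by rewrite divn_gt0 // dvdn_leq.
rewrite muln_gt0 r_gt0 num_gt0 /= mulnA -mulnDl; congr (Some (_ * _)).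
by rewrite [in RHS](quotient_residue M N_gt0) divnDr //= muln_divA.
Qed.

Lemma next_step l s l' s' i : onth P l = Some i -> instr_step i l s = (l', s') ->
  next M (state_code l s) = Some (state_code l' s').
Proof.
move=> Pl; have lt_l := onth_size Pl; have N_gt0 := state_code_gt0 l s.
have prime_at_gt0 j : 0 < prime_at j by rewrite prime_gt0 ?prime_prime_at.
have lt_r := PK Pl.
have fr := current_residue s (ltnW lt_l).
have dl : prime_at l.*2 %| code_modulus.
  by apply: dvdn_modulus1; rewrite ltn_double ltnS leq_max ltnW.
have dN : prime_at l.*2 %| state_code l s by rewrite dvdn_mulr.
case: i Pl lt_r => [r|r l1 l2] Pl /= lt_r.
  case=> <- <-; rewrite (@next_fraction _ (prime_at l.+1.*2 * prime_at r.*2.+1) (prime_at l.*2)) //.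
  - by rewrite /state_code mulKn // registers_inc // mulnC mulnA.
  - by rewrite muln_gt0 !prime_at_gt0.
  - by rewrite /fraction fr Pl.
case sr: (s r) => [|x] [<- <-].
  rewrite (@next_fraction _ (prime_at l2.*2) (prime_at l.*2)) //.
  - by rewrite /state_code mulKn // mulnC.
  - by rewrite /fraction fr Pl /= register_residue // sr.
rewrite (@next_fraction _ (prime_at l1.*2) (prime_at l.*2 * prime_at r.*2.+1)) //.
- by rewrite /state_code (registers_dec lt_r sr) mulnA mulKn ?muln_gt0 ?prime_at_gt0 // mulnC.
- have lt_r' : r.*2.+1 < (maxn (size P) K).+1.*2.
    by rewrite doubleS !ltnS leq_double leq_max (ltnW lt_r) orbT.
  have lt_l' : l.*2 < (maxn (size P) K).+1.*2 by rewrite ltn_double ltnS leq_max ltnW.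
  have [lt_lr|lt_rl|/(congr1 odd)] := ltngtP l.*2 r.*2.+1.
  + exact: dvdn_modulus.
  + by rewrite mulnC; apply: dvdn_modulus.
  + by rewrite /= !odd_double.
- by rewrite /state_code (registers_dec lt_r sr) mulnA dvdn_mulr.
by rewrite /fraction fr Pl /= register_residue // sr.
Qed.

Lemma next_halt s : next M (state_code (size P) s) = None.
Proof.
by rewrite /next /= /code_table /fraction current_residue // onth_default.
Qed.

Lemma run_reach l s s' : 1 < K -> reach P l s (size P) s' -> run M (state_code l s) (0 < s' 1).
Proof.
move=> lt_1K; move El: (size P) => e Hr.
elim: Hr El => {l s e s'} [l s|l s l1 s1 e s' i Pl step _ IH] El.
  rewrite -El -(@register_residue (size P) 1) //.
  exact/run_halt/next_halt.
exact: run_next (next_step Pl step) (IH El).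
Qed.

End Code.

(** Only terminating computations are traced; the system may do anything on the
others. The input is register 0, the output register 1, and the first instruction
has address 0. *)
Lemma simulation (p : murec 1) : exists (M : collatz) (n0 : nat -> nat),
  [/\ recursive (fun v : 1.-tuple nat => n0 (tnth v ord0)), forall x, 0 < n0 x
    & forall x y, murec_graph p [tuple x] y -> run M (n0 x) (0 < y)].
Proof.
have [//|//|//|c Hc] := @compile _ p (fun _ => 0) 1 2.
pose P := assemble c 0; pose K := (\max_(r <- map instr_register P) r).+2.
have PK l i : onth P l = Some i -> instr_register i < K.
  move=> Pl; rewrite ltnS leqW //; apply: (leq_bigmax_seq (F := id)) => //.
  by apply/onthP; exists l; rewrite onth_map Pl.
exists (machine_system P K), (fun x => prime_at 0 * prime_at 1 ^ x); split=> [|x|x y Hy].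
- apply: recursive_muln; first exact: recursive_const.
  by apply: recursive_expn; [apply: recursive_const | apply: recursive_proj].
- by rewrite muln_gt0 expn_gt0 !prime_gt0 // prime_prime_at.
pose s := upd (fun _ => 0) 0 x.
have Hs := Hc s [tuple x] y.
have /exec_reach/(_ 0 [::] [::] P) : exec c s (upd s 1 (s 1 + y)).
  apply: Hs => // [[|[|r]] //|i].
  by rewrite (tnth_nth 0); case: i => [[]].
rewrite cats0 => /(_ erefl erefl) /(run_reach PK).
rewrite [upd _ _ _ 1]/upd /= add0n.
have -> : state_code K 0 s = prime_at 0 * prime_at 1 ^ x; last exact.
rewrite /state_code /registers big_ord_recl /= big1 ?muln1 //.
Qed.

(** * Computing the code of the grammar *)

(** The step of [CodeSeq.code]. *)
Definition cons_code x m := 2 ^ x * m.*2.+1.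

Lemma recursive_cons_code n (F G : n.-tuple nat -> nat) :
  recursive F -> recursive G -> recursive (fun v => cons_code (F v) (G v)).
Proof.
move=> HF HG; apply: recursive_muln.
  by apply: recursive_expn HF; apply: recursive_const.
apply: recursive_S; apply: eq_recursive (recursive_addn HG HG) => v.
by rewrite addnn.
Qed.

Lemma recursive_iter_cons n (F G : n.-tuple nat -> nat) x :
  recursive F -> recursive G -> recursive (fun v => iter (F v) (cons_code x) (G v)).
Proof.
move=> HF HG; apply: (recursive_iter (F := fun _ => x)) => //.
  exact: recursive_const.
by apply: recursive_cons_code; apply: recursive_proj.
Qed.

Section GrammarCode.
Variables (A : finType) (a : A) (M : collatz).

Lemma code_block k rhs : CodeSeq.code (map (@symbol_code A) (block a k ++ rhs)) =
  iter k (cons_code (symbol_code (letter a))) (CodeSeq.code (map (@symbol_code A) rhs)).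
Proof. by elim: k => //= k ->. Qed.

Lemma recursive_grammar_code n (F : n.-tuple nat -> nat) : recursive F ->
  recursive (fun v => grammar_code (run_grammar a M (F v))).
Proof.
move=> HF.
have head rhs m (H : m.-tuple nat -> nat) : recursive H ->
    recursive (fun v => production_code (rule Head (block a (H v) ++ rhs))).
  move=> HH; have rhs_rec := recursive_const m (CodeSeq.code (map (@symbol_code A) rhs)).
  have := recursive_cons_code (recursive_const m (role_code Head))
    (recursive_iter_cons (symbol_code (letter a)) HH rhs_rec).
  by apply: eq_recursive => v; rewrite -code_block.
have step := recursive_cons_code
  (head [:: var A Sep] n.+2 _ (recursive_S (@recursive_thead n.+1))) (recursive_acc n).
have short := recursive_iteri (recursive_pred HF)
  (recursive_const n (grammar_code (common_rules a M))) step.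
have := recursive_cons_code (head [::] n _ (recursive_S HF)) short.
apply: eq_recursive => v; rewrite cats0 /run_grammar /grammar_code /=.
congr (cons_code _ _); elim: (F v).-1 => //= k ->.
by rewrite !theadE.
Qed.

End GrammarCode.

(** * Regularly total grammars are total *)

Section Total.
Variable A : finType.
Implicit Types G : grammar A.

Lemma symbol_code_inj : injective (@symbol_code A).
Proof.
case=> [c|X] [c'|X'] /=; last by case=> /double_inj ->.
- by move/double_inj/val_inj/enum_rank_inj->.
- by move/(congr1 odd); rewrite /= !odd_double.
- by move/(congr1 odd); rewrite /= !odd_double.
Qed.

Lemma grammar_code_inj : injective (@grammar_code A).
Proof.
move=> G G' /(can_inj CodeSeq.codeK)/inj_map; apply.
move=> [X s] [X' s'] /(can_inj CodeSeq.codeK) /= [-> /inj_map ->] //.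
exact: symbol_code_inj.
Qed.

(** A word longer than [n.+1] is [c u v] with [u] of length [n] and [v] non-empty:
[S => c Y T] produces it. *)
Lemma regularly_total_total G : regularly_total G -> total_grammar G.
Proof.
case=> Y [T [_ GT [n [n_gt0 short Yn]]]] [//|c w] _.
have [le_wn|lt_nw] := leqP (size (c :: w)) n.+1; first exact: short.
have T_any v : v != [::] -> der G [:: inr T] v.
  elim: v => // b v IHv _; have [_ GTb GTb'] := GT b.
  have [->|/IHv Tv] := eqVneq v [::]; first exact: der_production GTb (der_terminals _ [:: b]).
  exact: der_production GTb' (der_letter b Tv).
have [GS _ _] := GT c; apply: der_production GS _; apply: der_letter.
rewrite -(cat_take_drop n w); apply: (der_cat (s1 := [:: _])).
  by apply: Yn; rewrite size_takel // -ltnS ltnW.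
by apply: T_any; rewrite -size_eq0 size_drop subn_eq0 -ltnNge.
Qed.

Lemma disjoint_codes :
  classical_sets.setI (regularly_total_codes A) (non_total_codes A) = classical_sets.set0.
Proof.
apply/seteqP; split=> // m [[G [_ /regularly_total_total GT] <-] [G' [_ G'T] EG]].
by apply: G'T; rewrite (grammar_code_inj EG).
Qed.

End Total.

(** * A recursive pairing function *)

(** Since [(u + v)^2 <= pair_code u v < (u + v + 1)^2], the integer square root
recovers [u + v]. *)
Definition pair_code u v := (u + v) * (u + v) + u.

Definition root w := iteri w (fun k r => if r.+1 * r.+1 - k.+1 is 0 then r.+1 else r) 0.

Lemma rootP w : root w * root w <= w < (root w).+1 * (root w).+1.
Proof.
elim: w => // w; rewrite /root iteriS -/(root w).
by case E: (_ - _) => [|k]; lia.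
Qed.

Lemma root_pair u v : root (pair_code u v) = u + v.
Proof. by have := rootP (pair_code u v); rewrite /pair_code; nia. Qed.

Definition first w := w - root w * root w.
Definition second w := root w - first w.

Lemma first_pair u v : first (pair_code u v) = u.
Proof. by rewrite /first root_pair addKn. Qed.

Lemma second_pair u v : second (pair_code u v) = v.
Proof. by rewrite /second first_pair root_pair addKn. Qed.

Lemma recursive_root n (F : n.-tuple nat -> nat) :
  recursive F -> recursive (fun v => root (F v)).
Proof.
move=> HF; have Hr := @recursive_acc n; have Hk := @recursive_thead n.+1.
have := recursive_iteri HF (recursive_const n 0) (recursive_if0
  (recursive_subn (recursive_muln (recursive_S Hr) (recursive_S Hr)) (recursive_S Hk))
  (recursive_S Hr) Hr).
by apply: eq_recursive => v; apply: eq_iteri => k r; rewrite !theadE.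
Qed.

Lemma recursive_first n (F : n.-tuple nat -> nat) :
  recursive F -> recursive (fun v => first (F v)).
Proof.
move=> HF; have Hr := recursive_root HF.
exact: recursive_subn HF (recursive_muln Hr Hr).
Qed.

Lemma recursive_second n (F : n.-tuple nat -> nat) :
  recursive F -> recursive (fun v => second (F v)).
Proof. by move=> HF; apply: recursive_subn (recursive_root HF) (recursive_first HF). Qed.

Lemma recursive_pair n (F G : n.-tuple nat -> nat) :
  recursive F -> recursive G -> recursive (fun v => pair_code (F v) (G v)).
Proof.
move=> HF HG; have HD := recursive_addn HF HG.
exact: recursive_addn (recursive_muln HD HD) HF.
Qed.

(** * Diagonalization *)

(** The search for the least budget within which [g x] is seen to enter one of the two
sets. As the sets do not share [g x], the answer cannot be disturbed by the other
set. *)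
Lemma race (f : nat -> nat -> nat -> Prop) (g : nat -> nat) :
  partial_recursive2 f -> recursive (fun v : 1.-tuple nat => g (tnth v ord0)) ->
  exists2 psi : nat -> nat -> nat -> Prop, partial_recursive2 psi &
    forall u v x, ~ (W f u (g x) /\ W f v (g x)) ->
      (W f u (g x) -> psi (pair_code u v) x 1) /\ (W f v (g x) -> psi (pair_code u v) x 0).
Proof.
case=> p Hp Hg; have [E [E_rec _ EP]] := step_boundedP p.
pose halt s w x := E [tuple s; w; g x].
have WP w x : W f w (g x) <-> exists s, 0 < halt s w x.
  split=> [[y /Hp/EP[s Es]]|[s]]; first by exists s; rewrite /halt Es.
  case Es: (halt s w x) => [|y] // _; exists y; apply/Hp/EP; exists s; exact: Es.
have halt_rec n (S U X : n.-tuple nat -> nat) : recursive S -> recursive U -> recursive X ->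
    recursive (fun t => halt (S t) (U t) (X t)).
  move=> HS HU HX; apply: (recursive_subst E_rec).
  apply: tuple_recursive_cons HS _; apply: tuple_recursive_cons HU _.
  apply: tuple_recursive_cons; last exact: tuple_recursive_nil.
  exact: recursive_subst Hg (tuple_recursive_cons HX (@tuple_recursive_nil n)).
pose arg k (t : 3.-tuple nat) := tnth t (inord k).
have arg_rec k : recursive (arg k) by apply: recursive_proj.
pose left (t : 3.-tuple nat) := halt (arg 0 t) (first (arg 1 t)) (arg 2 t).
pose right (t : 3.-tuple nat) := halt (arg 0 t) (second (arg 1 t)) (arg 2 t).
have left_rec : recursive left by apply: halt_rec => //; apply: recursive_first.
have right_rec : recursive right by apply: halt_rec => //; apply: recursive_second.
have [q Hq] : recursive (fun t => 1 - (left t + right t)).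
  by apply: recursive_subn (recursive_const _ _) (recursive_addn left_rec right_rec).
have [r Hr] : recursive (fun t => if left t is 0 then 0 else 1).
  by apply: recursive_if0 left_rec (recursive_const _ _) (recursive_const _ _).
pose psi := MComp r (fun i : 'I_3 => if unlift ord0 i is Some j then MProj j else MMin q).
exists (fun w x y => murec_graph psi [tuple w; x] y); first by exists psi.
move=> u v x disj; set w := pair_code u v.
have leftE s : left [tuple s; w; x] = halt s u x.
  by rewrite /left /arg !(tnth_nth 0) !inordK //= first_pair.
have rightE s : right [tuple s; w; x] = halt s v x.
  by rewrite /right /arg !(tnth_nth 0) !inordK //= second_pair.
have psiP : (exists s, 0 < halt s u x + halt s v x) ->
    exists2 s, 0 < halt s u x + halt s v x &
    murec_graph psi [tuple w; x] (if halt s u x is 0 then 0 else 1).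
  move=> Hs; case: (ex_minnP Hs) => s Es min_s; exists s => //=.
  exists [tuple s; w; x]; split=> [i|]; last by apply/Hr; rewrite leftE.
  case: (unliftP ord0 i) => [j|] ->; first by rewrite tnthS.
  have -> : tnth [tuple s; w; x] ord0 = s by [].
  have consE j : [tuple of j :: [tuple w; x]] = [tuple j; w; x] by apply: val_inj.
  split=> [|j lt_js]; first by apply/Hq; rewrite consE leftE rightE; move: Es; lia.
  exists 0; apply/Hq; rewrite consE leftE rightE.
  have : ~~ (0 < halt j u x + halt j v x) by apply: contraL lt_js => /min_s; rewrite -leqNgt.
  by lia.
split=> Wx.
  have no_v s : halt s v x = 0.
    by case Es: (halt s v x) => [|k] //; case: disj; split=> //; apply/WP; exists s; rewrite Es.
  have [s Es] := (WP u x).1 Wx.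
  have [|s' + Hpsi] := psiP; first by exists s; rewrite addn_gt0 Es.
  by rewrite no_v addn0; case: (halt s' u x) Hpsi.
have no_u s : halt s u x = 0.
  by case Es: (halt s u x) => [|k] //; case: disj; split=> //; apply/WP; exists s; rewrite Es.
have [s Es] := (WP v x).1 Wx.
have [|s' _] := psiP; first by exists s; rewrite addn_gt0 Es orbT.
by rewrite no_u.
Qed.

Lemma total_recursive1P c :
  total_recursive1 c <-> recursive (fun v : 1.-tuple nat => c (tnth v ord0)).
Proof.
split=> -[p Hp]; exists p; last by move=> x y; rewrite (Hp [tuple x] y).
move=> v y; have {1}-> : v = [tuple tnth v ord0] by apply: eq_from_tnth => i; rewrite ord1.
by rewrite -Hp.
Qed.

Theorem theorem20 (A : finType) (hA : 1 < #|A|)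
    (f : nat -> nat -> nat -> Prop) (hf : acceptable_enumeration f) :
  effectively_inseparable f (regularly_total_codes A) (non_total_codes A).
Proof.
split; first exact: disjoint_codes.
have /card_gt1P[a [b [_ _ ab]]] := hA.
case: hf => _ f_rec smn.
have [d Hd] : exists d : murec 1, forall x y, f x x y -> murec_graph d [tuple x] y.
  case: f_rec => p Hp; exists (MComp p (fun _ => MProj ord0)) => x y /Hp Hxy /=.
  exists [tuple x; x]; split=> // i.
  by rewrite !(tnth_nth 0); case: i => [[|[]]].
have [M [n0 [n0_rec n0_gt0 n0_run]]] := simulation d.
pose g x := grammar_code (run_grammar a M (n0 x)).
have g_rec : recursive (fun v : 1.-tuple nat => g (tnth v ord0)) :=
  recursive_grammar_code a M n0_rec.
have [psi psi_rec psiP] := race f_rec g_rec.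
have [c /total_recursive1P c_rec cP] := smn psi psi_rec.
have gc_rec : recursive (fun v : 2.-tuple nat =>
    g (c (pair_code (tnth v ord0) (tnth v ord_max)))).
  have Hp := recursive_pair (recursive_proj (ord0 : 'I_2)) (recursive_proj (ord_max : 'I_2)).
  have sub1 h H : recursive (fun v : 1.-tuple nat => h (tnth v ord0)) -> @recursive 2 H ->
      recursive (fun v => h (H v)).
    move=> Hh HH.
    exact: recursive_subst Hh (tuple_recursive_cons HH (@tuple_recursive_nil 2)).
  exact: sub1 g_rec (sub1 _ _ c_rec Hp).
exists (fun u v z => z = g (c (pair_code u v))) => [|u v RW TW disj].
  by case: gc_rec => p Hp; exists p => x y z; rewrite Hp.
(* [e] is an index of the race on [u] and [v], run on its own index. *)
set e := c (pair_code u v); exists (g e) => //.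
have not_both : ~ (W f u (g e) /\ W f v (g e)).
  by move=> Wuv; have : (W f u `&` W f v)%classic (g e) by []; rewrite disj.
have [psi_u psi_v] := psiP u v e not_both.
have G_prod := productive_run_grammar a M (n0_gt0 e).
case=> [Wu|Wv]; apply: not_both; split=> //.
  have /cP/Hd/n0_run Hrun := psi_u Wu.
  apply: TW; exists (run_grammar a M (n0 e)) => //; split=> //.
  by apply: (not_total_run (n0_gt0 e)) Hrun; rewrite eq_sym; apply: ab.
have /cP/Hd/n0_run Hrun := psi_v Wv.
apply: RW; exists (run_grammar a M (n0 e)) => //; split=> //.
exact: regularly_total_run Hrun.
Qed.
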